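(* Let $(S_n)_{n\ge0}$ be a tampered memory elephant random walk (TMERW) with parameters $p,\lambda\in[0,1]$, whose memory sets $\mathcal{D}=(D_n)_{n\ge1}$ form a collection of nested sequences having an underlying renewal structure, with generic inter-arrival times $\tau$ and $\sigma$, and let $\mu=E[\tau]+E[\sigma]$. Then, as $n\to\infty$, $$\frac{S_n}{n}\longrightarrow\frac{(2\lambda-1)E[\sigma]}{\mu-(2p-1)E[\tau]}\quad\text{almost surely.}$$
   Context: TMERW: Fix $p,\lambda\in[0,1]$. Let $\mathcal{D}=(D_n)_{n\ge1}$ be a sequence of (deterministic or random) sets with $D_n\subseteq\{1,\dots,n\}$, and let $D_n^c=\{1,\dots,n\}\setminus D_n$. Let $X_1$ be a random variable with values in $\{-1,+1\}$ (arbitrary law); let $(Y_n)_{n\ge2}$ be i.i.d. with $P(Y_n=1)=1-P(Y_n=-1)=\lambda$ (the innovations); let $(\varepsilon_n)_{n\ge2}$ be i.i.d. with $P(\varepsilon_n=1)=1-P(\varepsilon_n=-1)=p$; let $(I_{n+1})_{n\ge1}$ be independent with $I_{n+1}$ uniform on $\{1,\dots,n\}$. The objects $X_1$, $\mathcal{D}$, $(Y_n)$, $(\varepsilon_n)$, $(I_n)$ are mutually independent. For $n\ge1$ define recursively $X_{n+1}=\varepsilon_{n+1}X_{I_{n+1}}$ if $I_{n+1}\notin D_n$, and $X_{n+1}=Y_{n+1}$ if $I_{n+1}\in D_n$. The TMERW is $S_0=0$, $S_n=X_1+\dots+X_n$. Nested sequences with renewal structure: Let $(L_n)_{n\ge1}$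 be a stochastic process with values in $\{0,1\}$, $L_1\equiv1$, and let $D_n^c=\{j\le n: L_j=1\}$, $D_n=\{j\le n: L_j=0\}$. Let $\mu_0=0$. Recursively, for $k\ge0$: if $\mu_k<\infty$, let $\tau_{k+1}=\inf\{n>\mu_k: L_{n+1}=0\}-\mu_k$, with value $\infty$ if the set is empty; if $\mu_k=\infty$, let $\tau_{k+1}=0$. If $\mu_k<\infty$ and $\tau_{k+1}<\infty$, let $\sigma_{k+1}=\inf\{n>\mu_k+\tau_{k+1}: L_{n+1}=1\}-\mu_k-\tau_{k+1}$, with value $\infty$ if the set is empty; otherwise let $\sigma_{k+1}=0$. Put $\mu_{k+1}=\mu_k+\tau_{k+1}+\sigma_{k+1}$. (So $\tau_k,\sigma_k$ are the lengths of the successive runs of 1's and of 0's.) The collection $\mathcal{D}$ has an underlying renewal structure if: (A1) $(\tau_n)_{n\ge1}$ is i.i.d., $(\sigma_n)_{n\ge1}$ is i.i.d., and the two sequences are independent of each other; $\tau,\sigma$ denote generic variables with the laws of $\tau_n,\sigma_n$; (A2) there exists $\delta>0$ such that $E[e^{t\tau}]<\infty$ and $E[e^{t\sigma}]<\infty$ for all $t\in(-\delta,\delta)$. *)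

(* Defs.v *)
From HB Require Import structures.
From mathcomp Require Import all_boot all_order all_algebra.
From mathcomp Require Import finmap.
From mathcomp Require Import all_classical all_reals all_analysis measurable_realfun.

Set Implicit Arguments.
Unset Strict Implicit.
Unset Printing Implicit Defensive.

Import Order.TTheory GRing.Theory Num.Theory.
Import numFieldNormedType.Exports.

Local Open Scope classical_set_scope.
Local Open Scope ring_scope.

Section independence.
Context d (T : measurableType d) (R : realType) (P : probability T R).

Definition mutually_independent (A : choiceType) (N : set A)
    (F : A -> set (set T)) : Prop :=
  forall (J : {fset A}) (E : A -> set T),
    [set` J] `<=` N -> (forall i, i \in J -> F i (E i)) ->
    P (\bigcap_(i in [set` J]) E i) = (\prod_(i <- J) P (E i))%E.

Definition independent2 (F G : set (set T)) : Prop :=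
  forall A B, F A -> G B -> P (A `&` B) = (P A * P B)%E.

Definition sigma_rv d' (V : measurableType d') (Z : T -> V) : set (set T) :=
  preimage_set_system setT Z measurable.

(* The sigma-algebra generated by the variables Z n with n in N; the values
   of Z at indices outside N are irrelevant. *)
Definition sigma_process d' (V : measurableType d') (N : set nat)
    (Z : nat -> T -> V) : set (set T) :=
  <<s \bigcup_(n in N) sigma_rv (Z n) >>.

Definition independent_seq d' (V : measurableType d') (N : set nat)
    (Z : nat -> T -> V) : Prop :=
  mutually_independent N (fun n => sigma_rv (Z n)).

Definition identically_distributed d' (V : measurableType d') (N : set nat)
    (Z : nat -> T -> V) : Prop :=
  forall m n B, N m -> N n -> measurable B -> P (Z m @^-1` B) = P (Z n @^-1` B).

Definition iid d' (V : measurableType d') (N : set nat)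
    (Z : nat -> T -> V) : Prop :=
  independent_seq N Z /\ identically_distributed N Z.

End independence.

Definition indices_from (m : nat) : set nat := [set n | (m <= n)%N].

Section tmerw.
Context d (T : measurableType d) (R : realType) (P : probability T R).

(* The law P(Z = 1) = 1 - P(Z = -1) = q. *)
Definition sign_law (q : R) (Z : T -> R) : Prop :=
  P [set w | Z w = 1] = q%:E /\ P [set w | Z w = -1] = (1 - q)%:E.

(* The sigma-algebra generated by a sequence of random subsets of nat. *)
Definition sigma_sets (D : nat -> T -> set nat) : set (set T) :=
  <<s [set A | exists n k, (1 <= n)%N /\ A = [set w | D n w k]] >>.

(* X and D are indexed from 1; Y, eps and I from 2. Values at smaller indices
   play no role. I_{n+1} lies in {1, ..., n} almost surely by tmerw_I_law. *)
Record TMERW (p lambda : R) (D : nat -> T -> set nat)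
    (X Y eps : nat -> {RV P >-> R}) (I : nat -> {RV P >-> nat}) : Prop := {
  tmerw_D_sub : forall n w, (1 <= n)%N ->
    D n w `<=` [set k | (1 <= k <= n)%N];
  tmerw_D_meas : forall n k, (1 <= n)%N -> measurable [set w | D n w k];
  tmerw_X1 : forall w, X 1%N w = 1 \/ X 1%N w = -1;
  tmerw_Y_iid : iid P (indices_from 2) Y;
  tmerw_Y_law : forall n, (2 <= n)%N -> sign_law lambda (Y n);
  tmerw_eps_iid : iid P (indices_from 2) eps;
  tmerw_eps_law : forall n, (2 <= n)%N -> sign_law p (eps n);
  tmerw_I_indep : independent_seq P (indices_from 2) I;
  tmerw_I_law : forall n k, (1 <= k <= n)%N ->
    P [set w | I n.+1 w = k] = (n%:R^-1)%:E;
  tmerw_indep : mutually_independent P [set: 'I_5]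
    (tnth [tuple sigma_rv (X 1%N); sigma_sets D; sigma_process (indices_from 2) Y;
                 sigma_process (indices_from 2) eps; sigma_process (indices_from 2) I]);
  tmerw_step_memory : forall n w, (1 <= n)%N -> ~ D n w (I n.+1 w) ->
    X n.+1 w = eps n.+1 w * X (I n.+1 w) w;
  tmerw_step_innovation : forall n w, (1 <= n)%N -> D n w (I n.+1 w) ->
    X n.+1 w = Y n.+1 w
}.

Definition walk (X : nat -> T -> R) (n : nat) (w : T) : R :=
  \sum_(1 <= i < n.+1) X i w.

End tmerw.

Section runs.
Context (R : realType).
Local Open Scope ereal_scope.

(* l is a path of the 0-1 process, true standing for 1. *)
Variable l : nat -> bool.

(* inf {n > m : l (n+1) = b}, which is +oo if there is no such n *)
Definition inf_after (m : \bar R) (b : bool) : \bar R :=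
  ereal_inf [set (n%:R : R)%:E | n in [set n : nat |
    m < (n%:R : R)%:E /\ l n.+1 = b]].

Definition ones_run (m : \bar R) : \bar R :=
  if m < +oo then inf_after m false - m else 0.

Definition zeros_run (m t : \bar R) : \bar R :=
  if (m < +oo) && (t < +oo) then inf_after (m + t) true - m - t else 0.

Fixpoint renewal_mu (k : nat) : \bar R :=
  if k is k'.+1 then
    let m := renewal_mu k' in
    let t := ones_run m in
    m + t + zeros_run m t
  else 0.

(* The lengths of the k-th run of ones and of the k-th run of zeros, k >= 1. *)
Definition renewal_tau (k : nat) : \bar R := ones_run (renewal_mu k.-1).

Definition renewal_sigma (k : nat) : \bar R :=
  zeros_run (renewal_mu k.-1) (renewal_tau k).

End runs.

Section renewal.
Context d (T : measurableType d) (R : realType) (P : probability T R).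
Variable L : nat -> {RV P >-> bool}.

Definition zeros_upto (n : nat) (w : T) : set nat :=
  [set j | (1 <= j <= n)%N /\ L j w = false].

Definition tau_ (k : nat) (w : T) : \bar R := renewal_tau R (fun n => L n w) k.

Definition sigma_ (k : nat) (w : T) : \bar R :=
  renewal_sigma R (fun n => L n w) k.

(* The generic variables tau and sigma are represented by the first members of
   the two identically distributed sequences. *)
Record renewal_structure : Prop := {
  renewal_L1 : forall w, L 1%N w = true;
  renewal_tau_iid : iid P (indices_from 1) tau_;
  renewal_sigma_iid : iid P (indices_from 1) sigma_;
  renewal_indep :
    independent2 P (sigma_process (indices_from 1) tau_)
      (sigma_process (indices_from 1) sigma_);
  renewal_exp_moments : exists2 delta : R, 0 < delta &
    forall t : R, - delta < t < delta ->
      (\int[P]_w expeR (t%:E * tau_ 1 w) < +oo)%E /\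
      (\int[P]_w expeR (t%:E * sigma_ 1 w) < +oo)%E
}.

Definition mean_tau : R := fine (\int[P]_w tau_ 1 w)%E.

Definition mean_sigma : R := fine (\int[P]_w sigma_ 1 w)%E.

End renewal.

(* Main.v *)
(* Write x_n = X_(n+1), l_n = 1 if L_(n+1) = 1 and 0 otherwise, beta = 2p - 1 and
   gamma = 2 lambda - 1. Conditionally on the past and on the whole sequence L,
   x_n has mean beta W_n + gamma Z_n, where W_n and Z_n are the averages over
   k < n of l_k x_k and of 1 - l_k. The differences xi_n between x_n and this
   mean, and the products l_n xi_n, are orthogonal and bounded, hence their
   averages vanish almost surely. The strong law for the run lengths gives
   frequency a = E tau / mu of ones, so W_n is, up to a vanishing term,
   beta (1/n) sum_(k < n) l_k W_k + gamma a (1 - a). Since |beta| a < 1 this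
   recursion contracts to its fixed point, and averaging beta W_n + gamma Z_n
   gives the limit gamma (1 - a) / (1 - beta a).

   Every function of the past is a linear combination of indicators of cylinder
   events, for which conditioning reduces to the product rule. *)
Require Import Defs.
From HB Require Import structures.
From mathcomp Require Import all_boot all_order all_algebra.
From mathcomp Require Import finmap.
From mathcomp Require Import all_classical all_reals all_analysis measurable_realfun.
From mathcomp Require Import ring lra zify.

Import Order.TTheory GRing.Theory Num.Theory.
Import numFieldNormedType.Exports.

Local Open Scope classical_set_scope.
Local Open Scope ring_scope.

(** * Averages of a reinforced sequence *)

Section averages.
Context {R : realType}.
Implicit Types u v : nat -> R.

(** Two noise averages are needed because [x] enters twice: the recursion for W_n sees only the
    positions with l_n = 1, hence l_n xi_n, while the final average sees all positions, hence xi_n.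
    The weight L_(n+1) is not a function of the walk up to time n; putting the whole sequence L into
    the past makes it predictable, and independence of L from the innovations keeps the conditional
    mean unchanged. Almost sure convergence rests on second moments. Orthogonality bounds the second
    moment of the n-th partial sum by a multiple of n, so the squared averages along the squares are
    summable in mean, and a lower bound on the terms fills the gaps between squares. Asking for a
    lower bound rather than boundedness lets one argument serve both the noise and the run lengths,
    which are unbounded above. When |beta| = 1 the contraction is still strict because a < 1: every
    run of zeros has length at least one. *)

Definition average u n : R := (\sum_(k < n) u k) / n%:R.

Lemma averageD u v n :
  average (fun k => u k + v k) n = average u n + average v n.
Proof. by rewrite /average big_split mulrDl. Qed.

Lemma averageZ c u n : average (fun k => c * u k) n = c * average u n.
Proof. by rewrite /average -mulr_sumr mulrA. Qed.

Lemma eq_average u v n : (forall k, (k < n)%N -> u k = v k) ->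
  average u n = average v n.
Proof. by move=> uv; rewrite /average; congr (_ / _); apply: eq_bigr => i _; exact: uv. Qed.

Lemma average_cvg u (l : R) : u n @[n --> \oo] --> l -> average u n @[n --> \oo] --> l.
Proof.
move=> /cesaro h; rewrite -cvg_shiftS.
apply: cvg_trans h; apply: near_eq_cvg; near=> n.
by rewrite /arithmetic_mean /average /= /series /= big_mkord mulrC.
Unshelve. all: by end_near. Qed.

Lemma average_norm_le1 u n : (forall k, (k < n)%N -> `|u k| <= 1) ->
  `|average u n| <= 1.
Proof.
move=> u1; rewrite /average normrM (@ger0_norm _ n%:R^-1) ?invr_ge0//.
have [->|n0] := posnP n; first by rewrite big_ord0 normr0 mul0r.
rewrite ler_pdivrMr ?ltr0n// mul1r; apply: le_trans (ler_norm_sum _ _ _) _.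
by rewrite -[n in n%:R]card_ord -sumr_const; apply: ler_sum => i _; exact: u1.
Qed.

Lemma cvg_invn : (n%:R : R)^-1 @[n --> \oo] --> (0 : R).
Proof. rewrite -cvg_shiftS; exact: cvg_harmonic. Qed.

(** In the contraction estimate the indices below the threshold contribute an amount bounded
    independently of [n], which division by [n] then removes. *)
Lemma sum_truncate_le K n (f : nat -> R) : (forall k, 0 <= f k) ->
  \sum_(k < n) (if (k < K)%N then f k else 0) <= \sum_(k < K) f k.
Proof.
move=> f0; rewrite -big_mkcond.
rewrite -(big_mkord (fun k => (k < K)%N) f) -(big_mkord xpredT f).
have [nK|Kn] := leqP n K.
  rewrite [leRHS](big_cat_nat (n := n))//= -[leLHS]addr0 lerD ?sumr_ge0//.
  rewrite big_nat_cond [leRHS]big_nat_cond.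
  by rewrite le_eqVlt; apply/orP; left; apply/eqP; apply: eq_bigl => i; lia.
rewrite [leLHS](big_cat_nat (n := K))//= ?(ltnW Kn)//.
rewrite big_nat_cond [leRHS]big_nat_cond [X in _ + X]big1_seq ?addr0; last first.
  by move=> i; rewrite mem_index_iota; lia.
by rewrite le_eqVlt; apply/orP; left; apply/eqP; apply: eq_bigl => i; lia.
Qed.

(* Iterating the estimate lowers any asymptotic bound c of |v| to theta c. *)
Lemma average_contraction (b a : R) (l : nat -> bool) v :
  0 <= a -> `|b| * a < 1 ->
  average (fun k => (l k)%:R) n @[n --> \oo] --> a ->
  (exists C, forall n, `|v n| <= C) ->
  (v n - b * average (fun k => (l k)%:R * v k) n) @[n --> \oo] --> (0 : R) ->
  v n @[n --> \oo] --> (0 : R).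
Proof.
move=> a0 ba la [C vC] hv.
(* The midpoint of [|b| * a] and 1: the gap above [|b| * a] absorbs every vanishing error term, and
   [q] stays below 1. *)
pose q := (1 + `|b| * a) / 2.
have ba0 : 0 <= `|b| * a by rewrite mulr_ge0.
have q0 : 0 < q by rewrite /q; lra.
have q1 : q < 1 by rewrite /q; lra.
have qba : `|b| * a < q by rewrite /q; lra.
have step c : 0 < c -> (\forall n \near \oo, `|v n| <= c) ->
    \forall n \near \oo, `|v n| <= q * c.
  move=> c0 [K _ vK].
  pose s := \sum_(k < K) `|v k|.
  have lim : (`|v n - b * average (fun k => (l k)%:R * v k) n| +
     `|b| * (s * n%:R^-1 + c * average (fun k => (l k)%:R) n)) @[n --> \oo]
     --> `|0 : R| + `|b| * (s * 0 + c * a).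
    apply: cvgD; first exact: cvg_norm.
    by apply: cvgMl_tmp; apply: cvgD; apply: cvgMl_tmp => //; exact: cvg_invn.
  have lt : `|0 : R| + `|b| * (s * 0 + c * a) < q * c.
    by rewrite normr0 mulr0 !add0r mulrCA mulrC ltr_pM2r.
  have [N _ HN] := cvgr_lt _ lim _ lt.
  exists N => // n Nn; apply: le_trans (ltW (HN n Nn)).
  pose A := b * average (fun k => (l k)%:R * v k) n.
  have := ler_normD (v n - A) A; rewrite subrK => /le_trans; apply.
  rewrite lerD2l normrM ler_wpM2l//.
  rewrite /average normrM (@ger0_norm _ n%:R^-1) ?invr_ge0// mulrA -mulrDl.
  rewrite ler_wpM2r ?invr_ge0//.
  apply: le_trans (ler_norm_sum _ _ _) _.
  have hk k : `|(l k)%:R * v k| <= (if (k < K)%N then `|v k| else 0) + c * (l k)%:R.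
    rewrite normrM; case: (l k); rewrite ?normr0 ?normr1 ?mul0r ?mul1r ?mulr0 ?mulr1.
      case: ltnP => kK; first by rewrite lerDl ltW.
      by rewrite add0r; exact: vK.
    by rewrite addr0; case: ifP.
  apply: (@le_trans _ _ (\sum_(k < n)
      ((if (k < K)%N then `|v k| else 0) + c * (l k)%:R))).
    by apply: ler_sum => k _; exact: hk.
  rewrite big_split /= mulr_sumr lerD2r.
  exact: (sum_truncate_le K n (fun k => `|v k|)).
(* The bound must be positive, since [step] needs the strict inequality between [|b| * a * c] and
   [q * c]. *)
pose C' := `|C| + 1.
have C0 : 0 < C' by rewrite /C' ltr_wpDl.
have iter j : \forall n \near \oo, `|v n| <= q ^+ j * C'.
  elim: j => [|j IH].
    rewrite mul1r; near=> n; apply: le_trans (vC n) _.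
    by apply: le_trans (ler_norm C) _; rewrite /C' lerDl ler01.
  by rewrite exprS -mulrA; apply: step => //; apply: mulr_gt0 => //; exact: exprn_gt0.
apply/cvgr0Pnorm_lt => e e0.
have : (q ^+ j * C' @[j --> \oo] --> 0 * C').
  by apply: cvgMr_tmp; apply: cvg_expr; rewrite gtr0_norm.
rewrite mul0r => /cvgr_lt/(_ e e0) [J _ HJ].
have := iter J; apply: filterS => n /le_lt_trans; apply; exact: (HJ J (leqnn J)).
Unshelve. all: by end_near. Qed.

Lemma reinforced_average_cvg (beta gamma a : R) (l : nat -> bool) (x : nat -> R) :
  let W n := average (fun k => (l k)%:R * x k) n in
  let Z n := average (fun k => (~~ l k)%:R) n in
  let xi n := x n - (beta * W n + gamma * Z n) in
  `|beta| <= 1 -> 0 <= a < 1 -> (forall n, `|x n| <= 1) ->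
  average (fun k => (l k)%:R) n @[n --> \oo] --> a ->
  average xi n @[n --> \oo] --> (0 : R) ->
  average (fun k => (l k)%:R * xi k) n @[n --> \oo] --> (0 : R) ->
  average x n @[n --> \oo] --> gamma * (1 - a) / (1 - beta * a).
Proof.
move=> W Z xi b1 /andP[a0 a1] x1 la hxi hlxi.
have ba : `|beta| * a < 1 by apply: le_lt_trans a1; rewrite ler_piMl.
have bap : 0 < 1 - beta * a.
  rewrite subr_gt0; apply: le_lt_trans (ler_norm _) _.
  by rewrite normrM (ger0_norm a0).
set s := gamma * (1 - a) / (1 - beta * a).
(* If [x] averages to [s], then W tends to [a * s] and Z to [1 - a], which forces this equation; its
   solution is the claimed limit. *)
have es : s = beta * (a * s) + gamma * (1 - a).
  by rewrite /s; field; rewrite gt_eqF.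
have Zcvg : Z n @[n --> \oo] --> 1 - a.
  have : (1 - average (fun k => (l k)%:R) n) @[n --> \oo] --> 1 - a.
    by apply: cvgB => //; exact: cvg_cst.
  apply: cvg_trans; apply: near_eq_cvg; near=> n.
  have n0 : n%:R != 0 :> R by rewrite pnatr_eq0 -lt0n; near: n; exists 1%N.
  have sumC : \sum_(k < n) (~~ l k)%:R = n%:R - \sum_(k < n) (l k)%:R :> R.
    rewrite -[n in n%:R]card_ord -sumr_const -sumrB; apply: eq_bigr => i _.
    by case: (l i); rewrite ?subrr ?subr0.
  by rewrite /Z /average sumC mulrBl divff.
pose v n := W n - a * s.
have vcvg : v n @[n --> \oo] --> (0 : R).
  apply: (average_contraction beta a l) => //.
    exists (1 + `|a * s|) => n; apply: le_trans (ler_normB _ _) _; rewrite lerD2r.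
    apply: average_norm_le1 => k _.
    by rewrite normrM; case: (l k); rewrite ?normr0 ?normr1 ?mul0r ?mul1r.
  (* Substituting [W = v + a * s] in [x = xi + beta W + gamma Z] and using [es] gives [x = xi + s +
     gamma (Z - (1 - a)) + beta v]. Multiplied by [l] and averaged, the [beta v] part is the
     contracting term and the rest is this vanishing error. *)
  have : (average (fun k => (l k)%:R * xi k) n
     + (s * (average (fun k => (l k)%:R) n - a)
     + average (fun k => (l k)%:R * (gamma * (Z k - (1 - a)))) n)) @[n --> \oo]
     --> (0 + (s * (a - a) + 0) : R).
    apply: cvgD => //; apply: cvgD.
      by apply: cvgMl_tmp; apply: cvgB => //; exact: cvg_cst.
    apply: average_cvg; apply/cvgr0Pnorm_lt => e e0.
    have : (gamma * (Z n - (1 - a))) @[n --> \oo] --> gamma * ((1 - a) - (1 - a)).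
      by apply: cvgMl_tmp; apply: cvgB => //; exact: cvg_cst.
    rewrite subrr mulr0 => /cvgr0Pnorm_lt /(_ e e0); apply: filterS => n.
    by apply: le_lt_trans; case: (l n); rewrite ?mul1r// mul0r normr0.
  rewrite subrr mulr0 !addr0; apply: cvg_trans; apply: near_eq_cvg; near=> n.
  have E : average (fun k => (l k)%:R * x k) n =
     average (fun k => (l k)%:R * xi k) n + average (fun k => s * (l k)%:R) n
     + average (fun k => (l k)%:R * (gamma * (Z k - (1 - a)))) n
     + average (fun k => beta * ((l k)%:R * v k)) n.
    rewrite -!averageD; apply: eq_average => k _.
    rewrite /xi /v {1}es -/(W k); ring.
  rewrite -[v n]/(average (fun k => (l k)%:R * x k) n - a * s) E !averageZ.
  ring.
have : (average xi n + average (fun k => beta * (v k + a * s) + gamma * Z k) n)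
   @[n --> \oo] --> (0 + (beta * (0 + a * s) + gamma * (1 - a))).
  apply: cvgD => //; apply: average_cvg.
  apply: cvgD; apply: cvgMl_tmp => //; apply: cvgD => //; exact: cvg_cst.
rewrite !add0r -es; apply: cvg_trans; apply: near_eq_cvg; near=> n.
by rewrite -averageD; apply: eq_average => k _; rewrite /v /xi; ring.
Unshelve. all: by end_near. Qed.

End averages.

(** * Averages of orthogonal sequences *)

Section square_subsequence.
Context {R : realType}.

Lemma sum_inv_square_le n : \sum_(m < n) ((m.+1 ^ 2)%:R : R)^-1 <= 2.
Proof.
(* The strengthened bound telescopes, as 1/(n+2)^2 is at most 1/(n+1) - 1/(n+2). *)
suff h : \sum_(m < n.+1) ((m.+1 ^ 2)%:R : R)^-1 <= 2 - n.+1%:R^-1.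
  apply: le_trans (_ : _ <= \sum_(m < n.+1) ((m.+1 ^ 2)%:R : R)^-1) _.
    by rewrite [leRHS]big_ord_recr /= lerDl invr_ge0.
  by apply: le_trans h _; rewrite gerBl invr_ge0.
elim: n => [|n IH].
  by rewrite big_ord1 exp1n invr1 lerBrDr -natr1.
rewrite big_ord_recr /=; apply: le_trans (lerD IH (lexx _)) _.
have n0 : 0 < n.+1%:R :> R by rewrite ltr0n.
have n1 : 0 < n.+2%:R :> R by rewrite ltr0n.
suff h : ((n.+2 ^ 2)%:R : R)^-1 <= n.+1%:R^-1 - n.+2%:R^-1.
  by apply: le_trans (lerD (lexx _) h) _; rewrite addrA subrK.
have -> : n.+1%:R^-1 - n.+2%:R^-1 = ((n.+1 * n.+2)%:R : R)^-1.
  rewrite natrM; have -> : n.+2%:R = n.+1%:R + 1 :> R by rewrite natr1.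
  move: (n.+1%:R : R) n0 => y y0.
  by field; rewrite !gt_eqF// addr_gt0.
by rewrite lef_pV2 ?posrE ?ltr0n// ler_nat -mulnn leq_mul2r ltnW ?orbT.
Qed.

Lemma square_floor n : exists m, (m ^ 2 <= n < m.+1 ^ 2)%N.
Proof.
elim: n => [|n [m /andP[mn nm]]]; first by exists 0%N.
have [h|h] := ltnP n.+1 (m.+1 ^ 2); first by exists m; rewrite h (leq_trans mn).
by exists m.+1; rewrite h/=; move: nm; rewrite -!mulnn; nia.
Qed.

(** The lower bound makes [S n + c * n] nondecreasing, so between two consecutive squares [S] is
    squeezed by its values at both ends, up to [c] times the gap. The gap is of the order of the
    square root of [n], hence negligible against [n]. *)
Lemma average_cvg0_squares (c : R) (u : nat -> R) : (forall k, - c <= u k) ->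
  average u (m.+1 ^ 2)%N @[m --> \oo] --> (0 : R) ->
  average u n @[n --> \oo] --> (0 : R).
Proof.
move=> uc hu.
pose S n := \sum_(k < n) u k.
have Srec n : S n.+1 = S n + u n by rewrite /S big_ord_recr.
have mono m n : (m <= n)%N -> S m - c * (n - m)%:R <= S n.
  move=> /subnKC <-; rewrite addKn; elim: (n - m)%N => [|j IH].
    by rewrite mulr0 subr0 addn0.
  rewrite addnS Srec -natr1 mulrDr mulr1.
  by have := uc (m + j)%N; move: IH; lra.
(* The factor 4 bounds (m+2)^2 / (m+1)^2, and 3 comes from the gap (m+2)^2 - (m+1)^2 = 2m + 3, at
   most 3(m+1). *)
have bound m n : (m.+1 ^ 2 <= n < m.+2 ^ 2)%N -> `|average u n| <=
    `|average u (m.+1 ^ 2)| + 4 * `|average u (m.+2 ^ 2)| + 3 * `|c| * m.+1%:R^-1.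
  move=> /andP[mn nm].
  have m0 : 0 < m.+1%:R :> R by rewrite ltr0n.
  have m2 : 0 < (m.+1 ^ 2)%:R :> R by rewrite ltr0n expn_gt0.
  have n0 : 0 < n%:R :> R by apply: lt_le_trans m2 _; rewrite ler_nat.
  have M2 : 0 < (m.+2 ^ 2)%:R :> R by rewrite ltr0n expn_gt0.
  have d1 : c * (n - m.+1 ^ 2)%:R <= `|c| * (3 * m.+1%:R).
    apply: le_trans (ler_norm _) _; rewrite normrM ler_wpM2l// ger0_norm//.
    by rewrite -natrM ler_nat; move: nm; rewrite -!mulnn; nia.
  have d2 : c * (m.+2 ^ 2 - n)%:R <= `|c| * (3 * m.+1%:R).
    apply: le_trans (ler_norm _) _; rewrite normrM ler_wpM2l// ger0_norm//.
    by rewrite -natrM ler_nat; move: mn; rewrite -!mulnn; nia.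
  have l1 := mono _ _ mn.
  have l2 := mono _ _ (ltnW nm).
  have Sn : `|S n| <= `|S (m.+1 ^ 2)%N| + `|S (m.+2 ^ 2)%N| + `|c| * (3 * m.+1%:R).
    have a1 := ler_norm (S (m.+2 ^ 2)%N); have a2 := lerNnormlW (lexx `|S (m.+1 ^ 2)%N|).
    have a3 := normr_ge0 (S (m.+1 ^ 2)%N); have a4 := normr_ge0 (S (m.+2 ^ 2)%N).
    by rewrite ler_norml; apply/andP; split; lra.
  rewrite /average !normrM -!/(S _).
  rewrite (@ger0_norm _ n%:R^-1) ?invr_ge0 ?(ltW n0)//.
  rewrite (@ger0_norm _ (m.+1 ^ 2)%:R^-1) ?invr_ge0 ?(ltW m2)//.
  rewrite (@ger0_norm _ (m.+2 ^ 2)%:R^-1) ?invr_ge0 ?(ltW M2)//.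
  apply: (@le_trans _ _ ((`|S (m.+1 ^ 2)%N| + `|S (m.+2 ^ 2)%N| +
     `|c| * (3 * m.+1%:R)) / (m.+1 ^ 2)%:R)).
    by apply: ler_pM => //; rewrite lef_pV2 ?posrE// ler_nat.
  rewrite [leLHS]mulrDl [X in X + _ <= _]mulrDl lerD// ?lerD2l.
    rewrite mulrCA ler_wpM2l// ler_pdivlMr// mulrC ler_pdivrMr//.
    by rewrite -natrM ler_nat -!mulnn; nia.
  rewrite natrX le_eqVlt; apply/orP; left; apply/eqP.
  by move: (m.+1%:R : R) m0 => y y0; field; rewrite gt_eqF.
have lim : (`|average u (m.+1 ^ 2)| + 4 * `|average u (m.+2 ^ 2)|
   + 3 * `|c| * m.+1%:R^-1) @[m --> \oo] --> (`|0 : R| + 4 * `|0 : R| + 3 * `|c| * 0).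
  apply: cvgD.
    apply: cvgD; first exact: cvg_norm.
    apply: cvgMl_tmp; apply: cvg_norm.
    by rewrite (cvg_shiftS (fun m => average u (m.+1 ^ 2)%N)).
  by apply: cvgMl_tmp; exact: cvg_harmonic.
move: lim; rewrite normr0 !mulr0 !addr0 => lim.
apply/cvgr0Pnorm_lt => e e0.
have [M _ HM] := cvgr_lt _ lim _ e0.
exists (M.+1 ^ 2)%N => // n /= Mn.
have [[|m] mn] := square_floor n.
  by exfalso; move: mn Mn; rewrite -!mulnn; case: n => //; lia.
apply: le_lt_trans (bound _ _ mn) _; apply: HM => /=.
by rewrite leqNgt; apply/negP => mM; move: mn Mn; rewrite -!mulnn; nia.
Qed.

Lemma nneseries_lty_cvg0 (u : nat -> R) : (forall n, 0 <= u n) ->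
  (\sum_(n <oo) (u n)%:E < +oo)%E -> u n @[n --> \oo] --> (0 : R).
Proof.
by move=> u0 s; apply: cvg_series_cvg_0; exact: nnseries_is_cvg.
Qed.

End square_subsequence.

Section law_of_large_numbers.
Context {d} {T : measurableType d} {R : realType} (P : probability T R).

(** Along the squares the mean square of the average is at most C / (m+1)^2. The series of these
    squares thus has a finite integral, is finite almost everywhere, and its terms tend to 0. *)
Lemma ae_average_cvg0 (c C : R) (f : nat -> T -> R) :
  (forall k, measurable_fun setT (f k)) ->
  (forall k, {ae P, forall w, - c <= f k w}) ->
  (forall n, (\int[P]_w ((\sum_(k < n) f k w) ^+ 2)%:E <= (C * n%:R)%:E)%E) ->
  {ae P, forall w, average (f^~ w) n @[n --> \oo] --> (0 : R)}.
Proof.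
move=> mf fc fC.
pose g (m : nat) (w : T) : \bar R := ((average (f^~ w) (m.+1 ^ 2)) ^+ 2)%:E.
have mS n : measurable_fun setT (fun w => \sum_(k < n) f k w).
  exact: measurable_sum.
have mg m : measurable_fun setT (g m).
  apply/measurable_EFinP; apply: measurable_funX.
  exact: measurable_funM.
have g0 m w : (0 <= g m w)%E by rewrite lee_fin sqr_ge0.
have ig m : (\int[P]_w g m w <= (C / (m.+1 ^ 2)%:R)%:E)%E.
  have p : 0 < (m.+1 ^ 2)%:R :> R by rewrite ltr0n expn_gt0.
  rewrite (eq_integral (fun w => ((m.+1 ^ 2)%:R ^- 2)%:E *
      ((\sum_(k < m.+1 ^ 2) f k w) ^+ 2)%:E)%E); last first.
    by move=> w _; rewrite /g /average -EFinM exprMn mulrC exprVn.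
  rewrite ge0_integralZl_EFin; last first.
  - by rewrite invr_ge0 exprn_ge0.
  - by apply/measurable_EFinP; exact: measurable_funX.
  - by move=> w _; rewrite lee_fin sqr_ge0.
  - exact: measurableT.
  apply: le_trans (lee_wpmul2l _ (fC _)) _; first by rewrite lee_fin invr_ge0 exprn_ge0.
  rewrite -EFinM lee_fin le_eqVlt; apply/orP; left; apply/eqP; field.
  by rewrite -?natrX ?gt_eqF// ?natr1 ltr0n.
have C0 : 0 <= C.
  have := le_trans (integral_ge0 _ (fun w _ => g0 0%N w)) (ig 0%N).
  by rewrite lee_fin exp1n divr1.
have sg : (\int[P]_w (\sum_(m <oo) g m w) < +oo)%E.
  rewrite integral_nneseries//.
  apply: (@le_lt_trans _ _ (C * 2)%:E); last exact: ltry.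
  apply: lime_le; first by apply: is_cvg_nneseries => n _ _; exact: integral_ge0.
  near=> n; rewrite big_mkord.
  apply: le_trans (lee_sum _ (fun i _ => ig (i : 'I_n))) _.
  rewrite sumEFin lee_fin -mulr_sumr ler_wpM2l//; exact: sum_inv_square_le.
have msg : measurable_fun setT (fun w => \sum_(m <oo) g m w)%E.
  by apply: ge0_emeasurable_sum => //.
have : P.-integrable setT (fun w => \sum_(m <oo) g m w)%E.
  apply/integrableP; split => //.
  under eq_integral do rewrite gee0_abs ?nneseries_ge0//.
  exact: sg.
move=> /(integrable_ae measurableT).
have := ae_foralln fc; apply: filterS2 => w wc /(_ Logic.I) wfin.
apply: (average_cvg0_squares c) => //.
have h : (average (f^~ w) (m.+1 ^ 2)) ^+ 2 @[m --> \oo] --> (0 : R).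
  apply: nneseries_lty_cvg0 => [m|]; first exact: sqr_ge0.
  rewrite -ge0_fin_numE; first exact: wfin.
  by apply: nneseries_ge0 => m _ _; exact: g0.
apply/cvgr0Pnorm_lt => e e0.
move/cvgr0Pnorm_lt : h => /(_ _ (exprn_gt0 2 e0)); apply: filterS => m.
by rewrite normrX ltr_pXn2r// nnegrE ltW.
Unshelve. all: by end_near. Qed.

End law_of_large_numbers.

Section orthogonal_sequences.
Context {d} {T : measurableType d} {R : realType} (P : probability T R).

Lemma ae_average_orthogonal_cvg0 (c C : R) (f : nat -> T -> R) :
  (forall k, measurable_fun setT (f k)) ->
  (forall k, {ae P, forall w, - c <= f k w}) ->
  (forall i j, P.-integrable setT (EFin \o (fun w => f i w * f j w))) ->
  (forall i j, (i < j)%N -> \int[P]_w (f i w * f j w) = 0) ->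
  (forall i, \int[P]_w (f i w * f i w) <= C) ->
  {ae P, forall w, average (f^~ w) n @[n --> \oo] --> (0 : R)}.
Proof.
move=> mf fc intf orth fC.
apply: (ae_average_cvg0 P c C) => // n.
pose S n w := \sum_(k < n) f k w.
have Srec m w : S m.+1 w = S m w + f m w by rewrite /S big_ord_recr.
(* Integrability and orthogonality to later terms share one induction: splitting the integral of the
   sum in the second claim requires the first. *)
have intSf m j : P.-integrable setT (EFin \o (fun w => S m w * f j w)) /\
    ((m <= j)%N -> \int[P]_w (S m w * f j w) = 0).
  elim: m => [|m [intm IH]].
    split=> [|_].
      apply: eq_integrable (integrable0 _ _) => // w _.
      by rewrite /= /S big_ord0 mul0r.
    rewrite (@eq_Rintegral _ _ _ P setT (fun=> 0)) ?Rintegral_cst ?mul0r// => w _.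
    by rewrite /S big_ord0 mul0r.
  have Sf w : S m.+1 w * f j w = S m w * f j w + f m w * f j w.
    by rewrite Srec mulrDl.
  split=> [|mj].
    apply: eq_integrable (integrableD _ intm (intf m j)) => // w _.
    by rewrite /= Sf EFinD.
  rewrite (eq_Rintegral _ (fun w _ => Sf w)) RintegralD// orth// addr0 IH//.
  exact: ltnW.
have intS m : P.-integrable setT (EFin \o (fun w => S m w ^+ 2)) /\
    \int[P]_w (S m w ^+ 2) <= C * m%:R.
  elim: m => [|m [intm IH]].
    split.
      apply: eq_integrable (integrable0 _ _) => // w _.
      by rewrite /= /S big_ord0 expr0n.
    rewrite mulr0 (@eq_Rintegral _ _ _ P setT (fun=> 0)) ?Rintegral_cst ?mul0r// => w _.
    by rewrite /S big_ord0 expr0n.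
  have [iSf /(_ (leqnn _)) oSf] := intSf m m.
  have i2 : P.-integrable setT (EFin \o (fun w => 2 * (S m w * f m w) + f m w * f m w)).
    by apply: eq_integrable (integrableD _ (integrableZl _ 2 iSf) (intf m m)).
  have Sf w : S m.+1 w ^+ 2 = S m w ^+ 2 + (2 * (S m w * f m w) + f m w * f m w).
    by rewrite Srec; ring.
  split.
    apply: eq_integrable (integrableD _ intm i2) => // w _.
    by rewrite /= Sf EFinD.
  rewrite (eq_Rintegral _ (fun w _ => Sf w)) RintegralD// -(@natr1 R m) mulrDr mulr1 lerD//.
  rewrite RintegralD//; last first.
    by apply: eq_integrable (integrableZl _ 2 iSf).
  by rewrite RintegralZl// oSf mulr0 add0r.
have [/integrable_fin_num fn SC] := intS n.
rewrite -lee_fin in SC; apply: le_trans SC.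
by rewrite /Rintegral fineK//; apply: fn.
Qed.

End orthogonal_sequences.

(** * A strong law for natural-valued variables *)

Section natural_valued.
Context {d} {T : measurableType d} {R : realType} (P : probability T R).

Lemma nat_tail_sum (n : nat) :
  (n%:R%:E = \sum_(m <oo) ((m < n)%N%:R)%:E :> \bar R)%E.
Proof.
rewrite (nneseries_split 0 n)//.
rewrite add0n eseries0 ?adde0; last by move=> k nk _; rewrite ltnNge nk.
rewrite sumEFin big_mkord (eq_bigr (fun=> 1)) => [|i _]; last by rewrite ltn_ord.
by rewrite sumr_const card_ord.
Qed.

(* The moments are computed from tail probabilities, as
   z = sum over m of the indicator of m < z. *)
Lemma ae_average_nat_iid (z : nat -> T -> R) :
  (forall k, measurable_fun setT (z k)) ->
  (forall k w, exists n, z k w = n%:R) ->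
  (forall k x, P [set w | x < z k w] = P [set w | x < z 0%N w]) ->
  (forall i j x y, i <> j -> P ([set w | x < z i w] `&` [set w | y < z j w]) =
     (P [set w | (x < z i w)%R] * P [set w | (y < z j w)%R])%E) ->
  (\int[P]_w (z 0%N w ^+ 2)%:E < +oo)%E ->
  P.-integrable setT (EFin \o z 0%N) /\
  {ae P, forall w, average (z^~ w) n @[n --> \oo] --> \int[P]_w z 0%N w}.
Proof.
move=> mz nz idz indz z2.
pose A k (m : nat) : set T := [set w | m%:R < z k w].
have mA k m : measurable (A k m).
  rewrite -[X in measurable X]setTI; apply: measurable_fun_ltr => //.
have tail k w : ((z k w)%:E = \sum_(m <oo) (\1_(A k m) w)%:E)%E.
  have [n zn] := nz k w; rewrite zn nat_tail_sum; apply: eq_eseriesr => m _.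
  rewrite indicE; congr ((nat_of_bool _)%:R%:E); apply/idP/idP => [mn|].
    by rewrite mem_set// /A /= zn ltr_nat.
  by move/set_mem; rewrite /A /= zn ltr_nat.
have z0 k w : 0 <= z k w by have [n ->] := nz k w.
have PA k m : P (A k m) = P (A 0%N m) by rewrite /A idz.
have Ez k : (\int[P]_w (z k w)%:E = \sum_(m <oo) P (A k m))%E.
  under eq_integral do rewrite tail.
  rewrite integral_nneseries//; last by move=> m; exact/measurable_EFinP.
  by apply: eq_eseriesr => m _; rewrite integral_indic// setIT.
have Ezz i j : (\int[P]_w (z i w * z j w)%:E =
    \sum_(m <oo) \sum_(l <oo) P (A i m `&` A j l))%E.
  have -> : (\int[P]_w (z i w * z j w)%:E =
      \int[P]_w (\sum_(m <oo) \sum_(l <oo) (\1_(A i m `&` A j l) w)%:E))%E.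
    apply: eq_integral => w _; rewrite EFinM muleC [X in (_ * X)%E]tail -nneseriesZl//.
    apply: eq_eseriesr => m _; rewrite muleC tail -nneseriesZl//.
    by apply: eq_eseriesr => l _; rewrite -EFinM indicI.
  rewrite integral_nneseries//; last first.
  - by move=> m w _; apply: nneseries_ge0.
  - move=> m; apply: ge0_emeasurable_sum => // l _.
    by apply/measurable_EFinP; apply: measurable_indic; exact: measurableI.
  apply: eq_eseriesr => m _; rewrite integral_nneseries//; last first.
    by move=> l; apply/measurable_EFinP; apply: measurable_indic; exact: measurableI.
  by apply: eq_eseriesr => l _; rewrite integral_indic ?setIT//; exact: measurableI.
have Ezk k : (\int[P]_w (z k w)%:E = \int[P]_w (z 0%N w)%:E)%E.
  by rewrite !Ez; apply: eq_eseriesr => m _.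
have Ezzk k : (\int[P]_w (z k w * z k w)%:E = \int[P]_w (z 0%N w * z 0%N w)%:E)%E.
  (* Tail events of one variable are nested, so its second moment too depends on tail probabilities
     alone and is the same for all [k]. *)
  have AA j m l : A j m `&` A j l = A j (maxn m l).
    apply/seteqP; split => w; rewrite /A /= natr_max gt_max; first by case=> -> ->.
    by move=> /andP.
  rewrite !Ezz; apply: eq_eseriesr => m _; apply: eq_eseriesr => l _.
  by rewrite !AA PA.
have mzz i j : measurable_fun setT (fun w => z i w * z j w) by exact: measurable_funM.
have izzk k : P.-integrable setT (EFin \o (fun w => z k w * z k w)).
  apply/integrableP; split; first exact/measurable_EFinP.
  under eq_integral do rewrite /= ger0_norm ?mulr_ge0//.
  by rewrite Ezzk; under eq_integral do rewrite -expr2.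
have izz i j : P.-integrable setT (EFin \o (fun w => z i w * z j w)).
  apply: le_integrable (integrableD _ (izzk i) (izzk j)) => //.
    exact/measurable_EFinP.
  move=> w _; rewrite /= lee_fin !ger0_norm ?addr_ge0 ?mulr_ge0//.
  have := sqr_ge0 (z i w - z j w); have := mulr_ge0 (z0 i w) (z0 j w).
  rewrite expr2; nra.
have iz k : P.-integrable setT (EFin \o z k).
  apply: le_integrable (izzk k) => //; first exact/measurable_EFinP.
  (* A natural number is at most its square, so integrability of the square is enough. *)
  move=> w _; rewrite /= lee_fin !ger0_norm ?mulr_ge0//.
  by have [n ->] := nz k w; rewrite -natrM ler_nat; case: n => // n; rewrite leq_pmull.
split; first exact: iz.
set mean := \int[P]_w z 0%N w.
have meanE k : \int[P]_w z k w = mean by rewrite /mean /Rintegral Ezk.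
have EmeanE k : (\int[P]_w (z k w)%:E = mean%:E)%E.
  by rewrite -(meanE k) /Rintegral fineK//; apply: (integrable_fin_num _ (iz k)).
have prod i j : i <> j -> \int[P]_w (z i w * z j w) = mean * mean.
  move=> ij; rewrite /Rintegral Ezz.
  rewrite (eq_eseriesr (g := fun m => (mean%:E * P (A i m))%E)) => [|m _].
    by rewrite nneseriesZl// -Ez EmeanE.
  rewrite muleC -(EmeanE j) Ez -(@fineK _ (P (A i m))) ?fin_num_measure//.
  rewrite -nneseriesZl//; apply: eq_eseriesr => l _.
  by rewrite fineK ?fin_num_measure// indz.
pose f k w := z k w - mean.
have ff i j w : f i w * f j w = z i w * z j w + (- mean * z i w + (- mean * z j w + mean * mean)).
  by rewrite /f; ring.
have i1 i : P.-integrable setT (EFin \o (fun w => - mean * z i w)).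
  by apply: eq_integrable (integrableZl _ (- mean) (iz i)).
have i2 : P.-integrable setT (EFin \o (fun _ : T => mean * mean)).
  exact: finite_measure_integrable_cst.
have i3 j : P.-integrable setT (EFin \o (fun w => - mean * z j w + mean * mean)).
  by apply: eq_integrable (integrableD _ (i1 j) i2).
have i4 i j : P.-integrable setT
    (EFin \o (fun w => - mean * z i w + (- mean * z j w + mean * mean))).
  by apply: eq_integrable (integrableD _ (i1 i) (i3 j)).
have E1 k : \int[P]_w (- mean * z k w) = - mean * mean by rewrite RintegralZl// meanE.
have E2 : \int[P]_(w in [set: T]) (mean * mean) = mean * mean.
  by rewrite Rintegral_cst//= [X in fine X](probability_setT P) mulr1.
have Eff i j : \int[P]_w (f i w * f j w) = \int[P]_w (z i w * z j w) - mean * mean.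
  rewrite (eq_Rintegral _ (fun w _ => ff i j w)) !RintegralD// !E1 E2; ring.
have : {ae P, forall w, average (f^~ w) n @[n --> \oo] --> (0 : R)}.
  apply: (ae_average_orthogonal_cvg0 P mean (\int[P]_w (z 0%N w * z 0%N w))).
  - by move=> k; exact: (measurable_funB (mz k) (measurable_cst mean)).
  (* Nonnegativity of [z] is what gives the centred variable a lower bound; it has no upper one. *)
  - by move=> k; apply: aeW => w; rewrite /f lerDr.
  - move=> i j; apply: eq_integrable (integrableD _ (izz i j) (i4 i j)) => // w _.
    by rewrite /= ff EFinD.
  - by move=> i j ij; rewrite Eff prod ?subrr// => eij; rewrite eij ltnn in ij.
  - by move=> k; rewrite Eff /Rintegral Ezzk gerBl sqr_ge0.
apply: filterS => w fw.
have : (average (f^~ w) n + mean) @[n --> \oo] --> 0 + mean.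
  by apply: cvgD => //; exact: cvg_cst.
rewrite add0r; apply: cvg_trans; apply: near_eq_cvg; near=> n.
have n0 : n%:R != 0 :> R by rewrite pnatr_eq0 -lt0n; near: n; exists 1%N.
rewrite /average /f sumrB mulrBl sumr_const card_ord -[mean *+ n]mulr_natr mulfK//.
by rewrite subrK.
Unshelve. all: by end_near. Qed.
End natural_valued.

(** * Runs of a 0-1 sequence *)

Section subsequence_ratio.
Context {R : realType}.

(** Renewal inversion: for [n] between [m K] and [m K.+1], monotonicity places [N n / n] between
    [N (m K) / m K.+1] and [N (m K.+1) / m K], and both bounds tend to [alpha / mu]. *)
Lemma ratio_cvg_of_subsequence (m : nat -> nat) (N : nat -> R) (alpha mu : R) :
  m 0%N = 0%N -> (forall K, (K <= m K)%N) -> {homo m : i j / (i <= j)%N} ->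
  {homo N : i j / (i <= j)%N >-> i <= j} -> (forall n, 0 <= N n) -> 0 < mu ->
  N (m K) / K%:R @[K --> \oo] --> alpha ->
  (m K)%:R / K%:R @[K --> \oo] --> mu ->
  N n / n%:R @[n --> \oo] --> alpha / mu.
Proof.
move=> m0 Km homm homN N0 mu0 cN cm.
have cK : K.+1%:R^-1 @[K --> \oo] --> (0 : R) by exact: cvg_harmonic.
have cN1 : N (m K.+1) / K.+1%:R @[K --> \oo] --> alpha.
  by rewrite (cvg_shiftS (fun K => N (m K) / K%:R)).
have cm1 : (m K.+1)%:R / K.+1%:R @[K --> \oo] --> mu.
  by rewrite (cvg_shiftS (fun K => (m K)%:R / K%:R : R)).
have nK K : K.+1%:R != 0 :> R by rewrite pnatr_eq0.
have mK K : (m K.+1)%:R != 0 :> R.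
  by rewrite pnatr_eq0 -lt0n (leq_trans _ (Km K.+1)).
(* Numerator and denominator sit at neighbouring block indices; the factor 1 - 1/(K+2) = (K+1)/(K+2)
   converts one normalisation into the other. *)
have r1 : N (m K.+1) / (m K.+2)%:R @[K --> \oo] --> alpha / mu.
  have : (N (m K.+1) / K.+1%:R * (1 - K.+2%:R^-1) * ((m K.+2)%:R / K.+2%:R)^-1)
      @[K --> \oo] --> alpha * (1 - 0) * mu^-1.
    apply: cvgM; last first.
      apply: cvgV; first by rewrite gt_eqF.
      by rewrite (cvg_shiftS (fun K => (m K.+1)%:R / K.+1%:R : R)).
    apply: cvgM => //; apply: cvgB; first exact: cvg_cst.
    by rewrite (cvg_shiftS (fun K => (K.+1%:R : R)^-1)).
  rewrite subr0 mulr1; apply: cvg_trans; apply: near_eq_cvg; near=> K.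
  have K2 : 1 - K.+2%:R^-1 = K.+1%:R / K.+2%:R :> R.
    have := nK K.+1; rewrite -(@natr1 R K.+1).
    by move: (K.+1%:R : R) => y y0; field.
  rewrite K2; move: (K.+1%:R : R) (K.+2%:R : R) ((m K.+2)%:R : R) (nK K) (nK K.+1) (mK K.+1).
  by move=> y z t y0 z0 t0; field; rewrite y0 z0 t0.
have r2 : N (m K.+2) / (m K.+1)%:R @[K --> \oo] --> alpha / mu.
  have : (N (m K.+2) / K.+2%:R * (1 + K.+1%:R^-1) * ((m K.+1)%:R / K.+1%:R)^-1)
      @[K --> \oo] --> alpha * (1 + 0) * mu^-1.
    apply: cvgM; last by apply: cvgV => //; rewrite gt_eqF.
    apply: cvgM; last by apply: cvgD => //; exact: cvg_cst.
    by rewrite (cvg_shiftS (fun K => N (m K.+1) / K.+1%:R)).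
  rewrite addr0 mulr1; apply: cvg_trans; apply: near_eq_cvg; near=> K.
  have K2 : 1 + K.+1%:R^-1 = K.+2%:R / K.+1%:R :> R.
    have := nK K; rewrite -(@natr1 R K.+1).
    by move: (K.+1%:R : R) => y y0; field.
  rewrite K2; move: (K.+1%:R : R) (K.+2%:R : R) ((m K.+1)%:R : R) (nK K) (nK K.+1) (mK K).
  by move=> y z t y0 z0 t0; field; rewrite y0 z0 t0.
have block n : exists K, (m K <= n < m K.+1)%N.
  have ex : exists K, (n < m K.+1)%N by exists n; exact: Km.
  case: (ex_minnP ex) => -[|K] nK1 Kmin.
    by exists 0%N; rewrite m0 nK1.
  exists K.+1; rewrite nK1 andbT leqNgt; apply/negP => /Kmin; rewrite ltnn //.
apply/cvgrPdist_lt => e e0.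
move/cvgrPdist_lt : r1 => /(_ e e0) [K1 _ HK1].
move/cvgrPdist_lt : r2 => /(_ e e0) [K2 _ HK2].
exists (m (maxn K1 K2).+1) => // n /= mn.
have [K /andP[Kn nK']] := block n.
have KK : (maxn K1 K2 < K)%N.
  rewrite ltnNge; apply/negP => h; have := homm K.+1 (maxn K1 K2).+1 h.
  by rewrite leqNgt (leq_ltn_trans mn nK').
case: K KK Kn nK' => // K; rewrite ltnS geq_max => /andP[K1K K2K] Kn nK'.
have {HK1} := HK1 K K1K; have {HK2} := HK2 K K2K => /=.
rewrite !ltr_distlC => /andP[_ h2] /andP[h1 _].
have mpos : 0 < (m K.+1)%:R :> R by rewrite ltr0n (leq_trans _ (Km K.+1)).
have npos : 0 < n%:R :> R by apply: lt_le_trans mpos _; rewrite ler_nat.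
apply/andP; split.
  apply: lt_le_trans h1 _; apply: ler_pM => //; first exact: homN.
  by rewrite lef_pV2 ?posrE ?(lt_le_trans npos)// ler_nat ltnW.
apply: le_lt_trans h2; apply: ler_pM => //; first exact/homN/ltnW.
by rewrite lef_pV2 ?posrE// ler_nat.
Unshelve. all: by end_near. Qed.

End subsequence_ratio.

Section run_lengths.
Context {R : realType} (l : nat -> bool).

(** The runs are defined by subtractions in the extended reals; this invariant keeps those values
    away from -oo and from non-integers. *)
Definition nat_or_infinite (z : \bar R) : Prop :=
  z = +oo%E \/ exists n : nat, z = n%:R%:E.

(** Since [fine] sends +oo to 0, finite parts are natural numbers everywhere, also on the null set
    where a run is infinite. *)
Lemma nat_or_infinite_fine z : nat_or_infinite z -> exists n : nat, fine z = n%:R.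
Proof. by case=> [->|[n ->]]; [exists 0%N|exists n]. Qed.

(** Either the set is empty and its infimum is +oo, or the infimum is attained at its least element;
    the third clause is minimality. It covers indices strictly after [m], so the value of [l m.+1]
    has to come from elsewhere. *)
Lemma inf_after_nat (m : nat) (b : bool) :
  inf_after l (m%:R%:E : \bar R) b = +oo%E \/
  exists n, [/\ (m < n)%N, l n.+1 = b, (forall j, (m < j < n)%N -> l j.+1 = ~~ b)
    & inf_after l (m%:R%:E : \bar R) b = n%:R%:E].
Proof.
have [[n0 n0P]|hn] := pselect (exists n, (m < n)%N && (l n.+1 == b)); last first.
  left; rewrite /inf_after (_ : [set n : nat | _ ] = set0) ?image_set0 ?ereal_inf0//.
  rewrite -subset0 => n /= [mn ln]; apply: hn; exists n.
  by move: mn; rewrite lte_fin ltr_nat ln eqxx andbT.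
right; have ex : exists n, (m < n)%N && (l n.+1 == b) by exists n0.
case: (ex_minnP ex) => n /andP[mn /eqP ln] nmin.
exists n; split => // [j /andP[mj jn]|].
  have : ~~ (l j.+1 == b).
    by apply/negP => lj; have := nmin j; rewrite mj lj leqNgt jn => /(_ isT).
  by case: (l j.+1) (b) => -[].
apply/eqP; rewrite eq_le; apply/andP; split.
  by apply: ereal_inf_lbound; exists n => //=; rewrite lte_fin ltr_nat mn.
apply: le_ereal_inf_tmp => _ [j /= [mj lj] <-].
by rewrite lee_fin ler_nat nmin// lj eqxx andbT -(ltr_nat R) -lte_fin.
Qed.

Lemma ones_run_nat z : nat_or_infinite z -> nat_or_infinite (ones_run l z).
Proof.
rewrite /ones_run; case=> [->|[m ->]]; first by rewrite ltxx; right; exists 0%N.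
rewrite ltry; case: (inf_after_nat m false) => [->|[n [mn _ _ ->]]]; first by left.
by right; exists (n - m)%N; rewrite -EFinB natrB// ltnW.
Qed.

Lemma zeros_run_nat z t : nat_or_infinite z -> nat_or_infinite t ->
  nat_or_infinite (zeros_run l z t).
Proof.
rewrite /zeros_run => -[->|[m ->]]; first by rewrite ltxx; right; exists 0%N.
case=> [->|[a ->]]; first by rewrite ltxx andbF; right; exists 0%N.
rewrite !ltry/= -?EFinD -natrD; case: (inf_after_nat (m + a) true) => [->|[n [mn _ _ ->]]].
  by left.
right; exists (n - m - a)%N; rewrite -!EFinB -subnDA natrB 1?ltnW// natrD.
by rewrite opprD addrA.
Qed.

Lemma renewal_mu_nat k : nat_or_infinite (renewal_mu R l k).
Proof.
elim: k => [|k IH] /=; first by right; exists 0%N.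
have ht := ones_run_nat _ IH; have hs := zeros_run_nat _ _ IH ht.
case: IH hs ht => [->|[m ->]]; last case=> [->|[b ->]]; last case=> [->|[a ->]].
- move=> [->|[b ->]] [->|[a ->]]; by left.
- by move=> [->|[a ->]]; left.
- by left.
- by right; exists (m + a + b)%N; rewrite !natrD.
Qed.

Lemma renewal_tau_nat k : nat_or_infinite (renewal_tau R l k).
Proof. exact/ones_run_nat/renewal_mu_nat. Qed.

Lemma renewal_sigma_nat k : nat_or_infinite (renewal_sigma R l k).
Proof. by apply: zeros_run_nat; [exact: renewal_mu_nat|exact: renewal_tau_nat]. Qed.

(** The hypothesis [l m.+1] is the loop invariant: a run of ones starts right after position [m].
    The infimum inspects only indices beyond [m], so without it the first site of the block would be
    unknown; the block ends by restoring it. *)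
Lemma renewal_block (k m : nat) : renewal_mu R l k = m%:R%:E -> l m.+1 ->
  (renewal_tau R l k.+1 < +oo)%E -> (renewal_sigma R l k.+1 < +oo)%E ->
  exists a b : nat, [/\ (0 < a)%N /\ (0 < b)%N,
    renewal_tau R l k.+1 = a%:R%:E /\ renewal_sigma R l k.+1 = b%:R%:E,
    renewal_mu R l k.+1 = (m + a + b)%:R%:E /\ l (m + a + b).+1,
    forall j, (j < a)%N -> l (m + j).+1 &
    forall j, (j < b)%N -> ~~ l (m + a + j).+1].
Proof.
move=> muk lm tfin sfin.
have muS : renewal_mu R l k.+1 =
    (m%:R%:E + renewal_tau R l k.+1 + renewal_sigma R l k.+1)%E.
  by rewrite -muk.
have tauE : renewal_tau R l k.+1 = ones_run l (m%:R%:E : \bar R).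
  by rewrite /renewal_tau /= muk.
have [a [a0 la ta la1]] : exists a, [/\ (0 < a)%N, l (m + a).+1 = false,
    renewal_tau R l k.+1 = a%:R%:E & forall j, (j < a)%N -> l (m + j).+1].
  move: tfin; rewrite tauE /ones_run ltry.
  case: (inf_after_nat m false) => [->//|[n [mn ln nmin ->]]] _.
  exists (n - m)%N; rewrite subn_gt0 mn subnKC 1?ltnW//; split => //.
    by rewrite -EFinB natrB// ltnW.
  case=> [|j] jn; first by rewrite addn0.
  by apply: nmin; lia.
have sE : renewal_sigma R l k.+1 =
    (inf_after l ((m + a)%:R%:E : \bar R) true - m%:R%:E - a%:R%:E)%E.
  by rewrite /renewal_sigma ta /= muk /zeros_run !ltry /= -EFinD -natrD.
have [b [b0 lb sb lb1]] : exists b, [/\ (0 < b)%N, l (m + a + b).+1,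
    renewal_sigma R l k.+1 = b%:R%:E & forall j, (j < b)%N -> ~~ l (m + a + j).+1].
  move: sfin; rewrite sE.
  case: (inf_after_nat (m + a) true) => [->//|[n [mn ln nmin ->]]] _.
  exists (n - (m + a))%N; rewrite subn_gt0 mn subnKC 1?ltnW//; split => //.
    by rewrite -!EFinB natrB 1?ltnW// natrD opprD addrA.
  case=> [|j] jn; first by rewrite addn0 la.
  by rewrite nmin//; lia.
by exists a, b; split => //; rewrite muS ta sb -!EFinD -!natrD.
Qed.

(** These are the inputs for inverting the renewal sums: the ones up to the end of the K-th block
    are exactly the sites of its [tau] runs, and [K <= m] holds because blocks are nonempty. *)
Lemma renewal_counts : l 1 ->
  (forall k, (renewal_tau R l k.+1 < +oo)%E) ->
  (forall k, (renewal_sigma R l k.+1 < +oo)%E) ->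
  forall K, exists m : nat, [/\ renewal_mu R l K = m%:R%:E, l m.+1, (K <= m)%N,
    m%:R = \sum_(k < K) (fine (renewal_tau R l k.+1) + fine (renewal_sigma R l k.+1)) &
    \sum_(i < m) (l i.+1)%:R = \sum_(k < K) fine (renewal_tau R l k.+1)].
Proof.
move=> l1 tfin sfin; elim=> [|K [m [muK lm Km ms ls]]].
  by exists 0%N; split => //; rewrite !big_ord0.
have [a [b [[a0 b0] [ta sb] [muS lS] la lb]]] :=
  renewal_block _ _ muK lm (tfin K) (sfin K).
exists (m + a + b)%N; split => //; first by lia.
  by rewrite big_ord_recr /= -ms ta sb /= !natrD addrA.
rewrite big_ord_recr [in RHS]/= -ls ta /= -addnA big_split_ord /=; congr (_ + _).
rewrite big_split_ord /= (eq_bigr (fun=> 1)) => [|i _]; last by rewrite la.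
rewrite sumr_const card_ord big1 ?addr0// => i _.
by rewrite addnA (negbTE (lb _ _)).
Qed.

End run_lengths.

(** * Frequency of ones of a renewal sequence *)

Section iid_natural_valued.
Context {d} {T : measurableType d} {R : realType} (P : probability T R).

Lemma measurable_expeR : measurable_fun [set: \bar R] (@expeR R).
Proof.
have -> : @expeR R = fun x => (if x == +oo then +oo
    else if x == -oo then 0 else (expR (fine x))%:E)%E.
  by apply/funext => -[x||].
apply: measurable_fun_ifT => //; first exact: measurable_fun_eqe.
apply: measurable_fun_ifT => //; first exact: measurable_fun_eqe.
apply/measurable_EFinP; apply: measurableT_comp; first exact: measurable_expR.
exact: fine_measurable.
Qed.

Lemma independent_seq_pair d' (V : measurableType d') (N : set nat)
    (Z : nat -> T -> V) (i j : nat) (B C : set V) :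
  independent_seq P N Z -> N i -> N j -> i <> j -> measurable B -> measurable C ->
  P ((Z i @^-1` B) `&` (Z j @^-1` C)) = (P (Z i @^-1` B) * P (Z j @^-1` C))%E.
Proof.
move=> indZ Ni Nj ij mB mC.
have ji : (j == i) = false by apply/eqP => ji; apply: ij.
have := indZ [fset i; j]%fset (fun k => if k == i then Z i @^-1` B else Z j @^-1` C).
have jin : (i \notin [fset j])%fset by rewrite inE eq_sym ji.
rewrite big_fsetU1//= big_seq_fset1 eqxx ji => <-.
- congr (P _); apply/seteqP; split => w /=.
    by move=> [wi wj] k /=; rewrite !inE => /orP[/eqP->|/eqP->]; rewrite ?eqxx ?ji.
  move=> h; split.
    by have := h i; rewrite /= !inE eqxx; apply.
  by have := h j; rewrite /= !inE eqxx orbT ji; apply.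
- by move=> k /=; rewrite !inE => /orP[/eqP->|/eqP->].
- move=> k; rewrite !inE => /orP[/eqP->|/eqP->]; rewrite ?eqxx ?ji.
    by exists B => //; rewrite setTI.
  by exists C => //; rewrite setTI.
Qed.

(** The exponential moment at [t] makes the value +oo negligible and dominates the square, so the
    law for natural-valued variables applies to the finite parts of [Z]. *)
Lemma ae_average_iid_nat (Z : nat -> T -> \bar R) (t : R) :
  (forall k, measurable_fun setT (Z k)) ->
  (forall k w, nat_or_infinite (Z k w)) ->
  iid P (indices_from 1) Z -> 0 < t ->
  (\int[P]_w expeR (t%:E * Z 1%N w) < +oo)%E ->
  [/\ {ae P, forall w, forall k, (Z k.+1 w < +oo)%E},
    P.-integrable setT (Z 1%N) &
    {ae P, forall w, average (fun k => fine (Z k.+1 w)) n @[n --> \oo] -->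
       fine (\int[P]_w Z 1%N w)%E}].
Proof.
move=> mZ nZ [indZ idZ] t0 expZ.
pose z k w := fine (Z k.+1 w).
have Z0 k w : (0 <= Z k w)%E.
  by case: (nZ k w) => [->|[n ->]]; rewrite ?leey ?lee_fin.
have mz k : measurable_fun setT (z k).
  by apply: measurableT_comp (mZ _); exact: fine_measurable.
have mexp : measurable_fun setT (fun w => expeR (t%:E * Z 1%N w)).
  apply: measurableT_comp measurable_expeR _.
  by apply: emeasurable_funM => //; exact: measurable_cst.
have fin1 : {ae P, forall w, (Z 1%N w < +oo)%E}.
  have : P.-integrable setT (fun w => expeR (t%:E * Z 1%N w)).
    apply/integrableP; split => //.
    by under eq_integral do rewrite gee0_abs ?expeR_ge0//.
  move=> /(integrable_ae measurableT); apply: filterS => w /(_ Logic.I).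
  case: (nZ 1%N w) => [->|[n ->]]; last by rewrite ltry.
  by rewrite gt0_muley ?lte_fin.
have mI k : measurable (Z k @^-1` [set +oo%E]).
  by rewrite -[X in measurable X]setTI; apply: mZ => //; exact: emeasurable_set1.
(* Finiteness is known for the first variable; identical distribution transfers it through the event
   that the value is +oo. *)
have fink k : {ae P, forall w, (Z k.+1 w < +oo)%E}.
  exists (Z k.+1 @^-1` [set +oo%E]); split => //.
    rewrite (idZ k.+1 1%N [set +oo%E] isT isT (emeasurable_set1 _)).
    apply/negligibleP => //; apply: negligibleS fin1 => w /= ->.
    by rewrite ltxx.
  move=> w /=; case: (nZ k.+1 w) => [->//|[n ->]].
  by rewrite ltry => /(_ isT).
have z2 : (\int[P]_w (z 0%N w ^+ 2)%:E < +oo)%E.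
  (* From 1 + y^2/2 <= exp y at y = t n. Where [Z 1] is +oo the left side is 0, by the value of
     [fine] there. *)
  have le w : ((z 0%N w ^+ 2)%:E <= (2 / t ^+ 2)%:E * expeR (t%:E * Z 1%N w))%E.
    rewrite /z; case: (nZ 1%N w) => [->|[n ->]] /=.
      rewrite expr0n/= gt0_muley ?lte_fin//= gt0_muley ?leey// lte_fin.
      by rewrite divr_gt0// exprn_gt0.
    rewrite -EFinM lee_fin -ler_pdivrMl ?divr_gt0 ?exprn_gt0//.
    have := @expR_ge1Dxn R (t * n%:R) 1 (mulr_ge0 (ltW t0) (ler0n _ _)).
    apply: le_trans; rewrite exprMn (_ : 2`! = 2)%N//.
    rewrite (_ : (2 / t ^+ 2)^-1 * n%:R ^+ 2 = t ^+ 2 * n%:R ^+ 2 / 2) ?lerDr//.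
    by field; rewrite gt_eqF.
  apply: (@le_lt_trans _ _ (\int[P]_w ((2 / t ^+ 2)%:E * expeR (t%:E * Z 1%N w)))%E).
    apply: ge0_le_integral => //.
    - by move=> w _; rewrite lee_fin sqr_ge0.
    - by apply/measurable_EFinP; exact: measurable_funX.
    - by apply: emeasurable_funM => //; exact: measurable_cst.
  rewrite ge0_integralZl_EFin//; last first.
  - by rewrite divr_ge0 ?exprn_ge0// ltW.
  - by move=> w _; exact: expeR_ge0.
  by rewrite lte_mul_pinfty// ?lee_fin ?divr_ge0 ?exprn_ge0// ltW.
have pre k x : [set w | x < z k w] = Z k.+1 @^-1` (fine @^-1` [set` `]x, +oo[]).
  by apply/seteqP; split => w /=; rewrite in_itv /= andbT.
have mpre x : measurable (fine @^-1` [set` `]x, +oo[] : set (\bar R)).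
  by rewrite -[X in measurable X]setTI; apply: fine_measurable.
have [iz cz] : P.-integrable setT (EFin \o z 0%N) /\
    {ae P, forall w, average (z^~ w) n @[n --> \oo] --> \int[P]_w z 0%N w}.
  apply: ae_average_nat_iid => //.
  - by move=> k w; exact: nat_or_infinite_fine.
  - by move=> k x; rewrite !pre; exact: idZ.
  - move=> i j x y ij; rewrite !pre.
    by apply: (independent_seq_pair _ _ (indices_from 1) Z i.+1 j.+1) => // -[].
have zE : ae_eq P setT (EFin \o z 0%N) (Z 1%N).
  by apply: filterS fin1 => w wfin _; rewrite /= fineK// ge0_fin_numE.
have IzE : (\int[P]_w (z 0%N w)%:E = \int[P]_w Z 1%N w)%E.
  by apply: ae_eq_integral => //; exact/measurable_EFinP.
split; first exact: ae_foralln.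
  apply/integrableP; split => //.
  under eq_integral do rewrite gee0_abs//.
  rewrite -IzE -ge0_fin_numE; last by apply: integral_ge0 => w _; rewrite lee_fin fine_ge0.
  exact: (integrable_fin_num _ iz).
by rewrite -IzE.
Qed.

End iid_natural_valued.

Section renewal_frequency.
Context {d} {T : measurableType d} {R : realType} (P : probability T R).
Variable L : nat -> {RV P >-> bool}.

(** The index set of the infimum depends on [w]. Giving the value +oo to the indices outside it
    turns the expression into a countable infimum of measurable functions. *)
Lemma measurable_inf_after (M : T -> \bar R) (b : bool) : measurable_fun setT M ->
  measurable_fun setT (fun w => inf_after (fun n => L n w) (M w) b).
Proof.
move=> mM.
pose g n w : \bar R :=
  if (M w < n%:R%:E)%E && (L n.+1 w == b) then n%:R%:E else +oo%E.
have -> : (fun w => inf_after (fun n => L n w) (M w) b) =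
    (fun w => einfs (g^~ w) 0%N).
  apply/funext => w; apply/eqP; rewrite eq_le; apply/andP; split.
    apply: le_ereal_inf_tmp => _ [n _ <-]; rewrite /g; case: ifP; last by rewrite leey.
    by move=> /andP[h1 /eqP h2]; apply: ereal_inf_lbound; exists n.
  apply: le_ereal_inf_tmp => _ [n [h1 h2] <-]; apply: ereal_inf_lbound.
  by exists n => //; rewrite /g h1 h2 eqxx.
apply: measurable_fun_einfs => n; apply: measurable_fun_ifT => //.
apply: measurable_and; first exact: measurable_fun_lte.
apply: (measurable_fun_bool true) => //.
rewrite (_ : _ @^-1` _ = L n.+1 @^-1` [set b]); last first.
  by apply/seteqP; split => w /= /eqP.
exact: measurable_funP.
Qed.

Lemma measurable_ones_run (M : T -> \bar R) : measurable_fun setT M ->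
  measurable_fun setT (fun w => ones_run (fun n => L n w) (M w)).
Proof.
move=> mM; apply: measurable_fun_ifT => //; first exact: measurable_fun_lte.
by apply: emeasurable_funB => //; exact: measurable_inf_after.
Qed.

Lemma measurable_zeros_run (M N : T -> \bar R) :
  measurable_fun setT M -> measurable_fun setT N ->
  measurable_fun setT (fun w => zeros_run (fun n => L n w) (M w) (N w)).
Proof.
move=> mM mN; apply: measurable_fun_ifT => //.
  by apply: measurable_and; exact: measurable_fun_lte.
apply: emeasurable_funB => //; apply: emeasurable_funB => //.
by apply: measurable_inf_after; exact: emeasurable_funD.
Qed.

Lemma measurable_renewal_mu k :
  measurable_fun setT (fun w => renewal_mu R (fun n => L n w) k).
Proof.
elim: k => [|k IH] /=; first exact: measurable_cst.
apply: emeasurable_funD.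
  by apply: emeasurable_funD => //; exact: measurable_ones_run.
by apply: measurable_zeros_run => //; exact: measurable_ones_run.
Qed.

Lemma measurable_tau k : measurable_fun setT (tau_ L k).
Proof. by apply: measurable_ones_run; exact: measurable_renewal_mu. Qed.

Lemma measurable_sigma k : measurable_fun setT (sigma_ L k).
Proof.
by apply: measurable_zeros_run; [exact: measurable_renewal_mu|exact: measurable_tau].
Qed.

Lemma renewal_frequency : renewal_structure L ->
  [/\ 0 <= mean_tau L, 0 < mean_sigma L &
   {ae P, forall w, average (fun k => (L k.+1 w)%:R) n @[n --> \oo] -->
     mean_tau L / (mean_tau L + mean_sigma L)}].
Proof.
move=> [L1 tau_iid sigma_iid _ [delta delta0 expm]].
have d2 : 0 < delta / 2 by rewrite divr_gt0.
have [exp_tau exp_sigma] : (\int[P]_w expeR ((delta / 2)%:E * tau_ L 1 w) < +oo)%E /\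
    (\int[P]_w expeR ((delta / 2)%:E * sigma_ L 1 w) < +oo)%E.
  by apply: expm; rewrite ltr_pdivrMr// ltr_pMr//; apply/andP; split; lra.
have [tfin it ct] := ae_average_iid_nat P _ _ measurable_tau
  (fun k w => renewal_tau_nat _ k) tau_iid d2 exp_tau.
have [sfin is_ cs] := ae_average_iid_nat P _ _ measurable_sigma
  (fun k w => renewal_sigma_nat _ k) sigma_iid d2 exp_sigma.
have tau0 k w : (0 <= tau_ L k w)%E.
  by case: (renewal_tau_nat (R := R) (fun n => L n w) k) => [|[n]]; rewrite /tau_ => ->;
     rewrite ?leey// lee_fin.
have sigma0 k w : (0 <= sigma_ L k w)%E.
  by case: (renewal_sigma_nat (R := R) (fun n => L n w) k) => [|[n]]; rewrite /sigma_ => ->;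
     rewrite ?leey// lee_fin.
have mt0 : 0 <= mean_tau L by rewrite fine_ge0// integral_ge0.
(* A finite run of zeros contains at least one site, so [sigma] is at least 1 almost surely.
   Positivity of its mean makes the frequency of ones strictly less than 1. *)
have ms0 : 0 < mean_sigma L.
  apply: (@lt_le_trans _ _ 1) => //.
  rewrite -lee_fin /mean_sigma fineK; last exact: (integrable_fin_num _ is_).
  have <- : (\int[P]_(w in [set: T]) 1 = 1)%E.
    by rewrite integral_cst// mul1e; exact: probability_setT.
  apply: ae_ge0_le_integral => //; first exact: measurable_sigma.
  apply: filterS2 tfin sfin => w /(_ 0%N) tw /(_ 0%N) sw _.
  have [a [b [[_ b0] [_ sb] _ _ _]]] :=
    renewal_block (R := R) (fun n => L n w) 0 0 erefl (L1 w) tw sw.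
  by rewrite /sigma_ sb lee_fin ler1n.
split => //.
have tsfin : {ae P, forall w, (forall k, (tau_ L k.+1 w < +oo)%E) /\
    (forall k, (sigma_ L k.+1 w < +oo)%E)} by apply: filterS2 tfin sfin.
apply: filterS3 tsfin ct cs => w [tw sw] ctw csw.
have [m mP] := choice (renewal_counts (R := R) (fun n => L n w) (L1 w) tw sw).
have m0 : m 0%N = 0%N.
  have [_ _ _ + _] := mP 0%N; rewrite big_ord0 => /eqP.
  by rewrite pnatr_eq0 => /eqP.
have mS K : (m K <= m K.+1)%N.
  rewrite -(ler_nat R); have [_ _ _ -> _] := mP K; have [_ _ _ -> _] := mP K.+1.
  rewrite big_ord_recr /= lerDl addr_ge0// fine_ge0//.
    exact: (tau0 K.+1 w).
  exact: (sigma0 K.+1 w).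
apply: (ratio_cvg_of_subsequence m (fun n => \sum_(k < n) (L k.+1 w)%:R)) => //.
- by move=> K; have [_ _ ->] := mP K.
- exact: homo_leq leqnn leq_trans mS.
- apply: homo_leq lexx le_trans _ => n.
  by rewrite big_ord_recr /= lerDl.
- by move=> n; apply: sumr_ge0.
- by rewrite ltr_wpDl.
- apply: cvg_trans ctw; apply: near_eq_cvg; near=> K.
  by rewrite /average; have [_ _ _ _ ->] := mP K.
- have : (average (fun k => fine (tau_ L k.+1 w)) n +
      average (fun k => fine (sigma_ L k.+1 w)) n) @[n --> \oo]
      --> mean_tau L + mean_sigma L by exact: cvgD.
  apply: cvg_trans; apply: near_eq_cvg; near=> K.
  by rewrite -averageD /average; have [_ _ _ -> _] := mP K.
Unshelve. all: by end_near. Qed.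

End renewal_frequency.

(** * Spans of indicators *)

Section indicator_span.
Context {d} {T : measurableType d} {R : realType} (P : probability T R).

Lemma ae_bounded_integrable (M : R) (f : T -> R) : measurable_fun setT f ->
  {ae P, forall w, `|f w| <= M} -> P.-integrable setT (EFin \o f).
Proof.
move=> mf fM; apply/integrableP; split; first exact/measurable_EFinP.
have mnf : measurable_fun setT (fun w => `|(f w)%:E|%E).
  by apply: measurableT_comp => //; exact/measurable_EFinP.
apply: (@le_lt_trans _ _ (\int[P]_(w in setT) `|M|%:E)%E).
  apply: ae_ge0_le_integral => //.
  apply: filterS fM => w fM _; rewrite lee_fin.
  exact: le_trans fM (ler_norm _).
by rewrite integral_cst// [X in (_ * X)%E](probability_setT P) mule1 ltry.
Qed.

Lemma ae_bounded_Rintegral_le (M : R) (f : T -> R) : measurable_fun setT f ->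
  {ae P, forall w, `|f w| <= M} -> \int[P]_w f w <= M.
Proof.
move=> mf fM; have intf := ae_bounded_integrable M f mf fM.
have -> : M = \int[P]_(w in setT) M.
  by rewrite Rintegral_cst//= [X in fine X](probability_setT P) mulr1.
rewrite -subr_ge0 -RintegralB//; last exact: finite_measure_integrable_cst.
rewrite /Rintegral fine_ge0//.
(* [M - f] is nonnegative only almost everywhere; its absolute value is so everywhere and has the
   same integral. *)
rewrite (@ae_eq_integral _ _ _ P setT (fun w => (`|M - f w|)%:E))//.
- by apply: integral_ge0.
- by apply/measurable_EFinP; exact: measurable_funB.
- by apply/measurable_EFinP; apply: measurableT_comp => //; exact: measurable_funB.
- apply: filterS fM => w fM _; rewrite /= ger0_norm// subr_ge0.
  exact: le_trans (ler_norm _) fM.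
Qed.

Lemma ae_eq_Rintegral (f g : T -> R) : measurable_fun setT f -> measurable_fun setT g ->
  {ae P, forall w, f w = g w} -> \int[P]_w f w = \int[P]_w g w.
Proof.
move=> mf mg fg; congr fine; apply: ae_eq_integral => //; [exact/measurable_EFinP..|].
by apply: filterS fg => w -> _.
Qed.

(** Closure under almost everywhere equality is needed because the signs and the range of [I] hold
    only almost surely, so the walk agrees with a combination of indicators off a null set.
    Measurability of [g] is required since the probability space need not be complete. *)
Inductive indicator_span (C : set (set T)) : (T -> R) -> Prop :=
| span_indic A : C A -> indicator_span C \1_A
| span_lin a b f g : indicator_span C f -> indicator_span C g ->
    indicator_span C (fun w => a * f w + b * g w)
| span_ae f g : indicator_span C f -> measurable_fun setT g ->
    {ae P, forall w, f w = g w} -> indicator_span C g.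

Lemma indicator_span_sub (C D : set (set T)) f : C `<=` D ->
  indicator_span C f -> indicator_span D f.
Proof.
move=> CD; elim=> {f} [A CA|a b f g _ f1 _ g1|f g _ f1 mg fg].
- exact/span_indic/CD.
- exact: span_lin.
- exact: span_ae fg.
Qed.

Variable C : set (set T).
Hypothesis C_measurable : C `<=` measurable.
Hypothesis C_setT : C setT.
Hypothesis C_setI : forall A B, C A -> C B -> C (A `&` B).

Local Notation span := (indicator_span C).

Lemma span_measurable f : span f -> measurable_fun setT f.
Proof.
elim=> {f} [A CA|a b f g _ mf _ mg|//].
  exact/measurable_indic/C_measurable.
by apply: measurable_funD; apply: measurable_funM.
Qed.

Lemma span_bounded f : span f -> exists M, {ae P, forall w, `|f w| <= M}.
Proof.
elim=> {f} [A CA|a b f g _ [M fM] _ [N gN]|f g _ [M fM] _ fg].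
- exists 1; apply: aeW => w; rewrite indicE.
  by case: (_ \in _); rewrite ?normr0 ?normr1.
- exists (`|a| * M + `|b| * N); apply: filterS2 fM gN => w fM gN.
  by apply: le_trans (ler_normD _ _) _; rewrite !normrM lerD// ler_wpM2l.
- by exists M; apply: filterS2 fM fg => w + <-.
Qed.

Lemma span_integrable f : span f -> P.-integrable setT (EFin \o f).
Proof.
move=> sf; have [M fM] := span_bounded f sf.
by apply: (ae_bounded_integrable M) => //; exact: span_measurable.
Qed.

Lemma eq_span f g : span f -> f =1 g -> span g.
Proof. by move=> sf /funext <-. Qed.

Lemma span_cst c : span (fun=> c).
Proof.
apply: (eq_span (fun w => c * \1_setT w + 0 * \1_setT w)) => [|w].
  by apply: span_lin; exact: span_indic.
by rewrite mul0r addr0 indicT mulr1.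
Qed.

Lemma spanD f g : span f -> span g -> span (fun w => f w + g w).
Proof.
move=> sf sg; apply: (eq_span _ _ (span_lin _ 1 1 _ _ sf sg)) => w.
by rewrite !mul1r.
Qed.

Lemma spanZ c f : span f -> span (fun w => c * f w).
Proof.
move=> sf; apply: (eq_span _ _ (span_lin _ c 0 _ _ sf sf)) => w.
by rewrite mul0r addr0.
Qed.

Lemma spanB f g : span f -> span g -> span (fun w => f w - g w).
Proof.
move=> sf sg; apply: (eq_span _ _ (span_lin _ 1 (-1) _ _ sf sg)) => w.
by rewrite mul1r mulN1r.
Qed.

Lemma span_sum n (f : nat -> T -> R) : (forall k, (k < n)%N -> span (f k)) ->
  span (fun w => \sum_(k < n) f k w).
Proof.
elim: n => [|n IH] sf.
  by apply: (eq_span _ _ (span_cst 0)) => w; rewrite big_ord0.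
apply: (eq_span (fun w => \sum_(k < n) f k w + f n w)) => [|w].
  by apply: spanD; [apply: IH => k kn; apply: sf; rewrite ltnW|exact: sf].
by rewrite big_ord_recr.
Qed.

(** Induction on both factors reduces the product to two indicators, where stability of [C] under
    intersection is used. *)
Lemma spanM f g : span f -> span g -> span (fun w => f w * g w).
Proof.
move=> sf sg; have mg := span_measurable _ sg.
elim: sf => {f} [A CA|a b f1 f2 s1 IH1 s2 IH2|f1 f2 s1 IH1 mf2 f12].
- elim: sg {mg} => {g} [B CB|a b g1 g2 s1 IH1 s2 IH2|g1 g2 s1 IH1 mg2 g12].
  + apply: (eq_span \1_(A `&` B)) => [|w]; first exact/span_indic/C_setI.
    by rewrite indicI.
  + by apply: (eq_span _ _ (span_lin _ a b _ _ IH1 IH2)) => w; ring.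
  + apply: (span_ae _ _ _ IH1).
      by apply: measurable_funM => //; apply: measurable_indic; exact: C_measurable.
    by apply: filterS g12 => w ->.
- by apply: (eq_span _ _ (span_lin _ a b _ _ IH1 IH2)) => w; ring.
- apply: (span_ae _ _ _ IH1); first exact: measurable_funM.
  by apply: filterS f12 => w ->.
Qed.

(** This replaces conditioning: the product rule on [C] extends to the span by linearity, with no
    monotone class argument. *)
Lemma span_independent (B : set T) : measurable B ->
  (forall A, C A -> P (A `&` B) = (P A * P B)%E) ->
  forall f, span f -> \int[P]_w (f w * \1_B w) = \int[P]_w f w * fine (P B).
Proof.
move=> mB indB f sf.
have mI : measurable_fun setT (\1_B : T -> R) by exact: measurable_indic.
have intB g : span g -> P.-integrable setT (EFin \o (fun w => g w * \1_B w)).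
  move=> sg; have [M gM] := span_bounded _ sg.
  apply: (ae_bounded_integrable M).
    by apply: measurable_funM => //; exact: span_measurable.
  apply: filterS gM => w; apply: le_trans; rewrite indicE.
  by case: (_ \in _); rewrite ?mulr1// mulr0 normr0.
elim: sf => {f} [A CA|a b f1 f2 s1 IH1 s2 IH2|f1 f2 s1 IH1 mf2 f12].
- have mA := C_measurable _ CA.
  rewrite (@eq_Rintegral _ _ _ P setT \1_(A `&` B)); last by move=> w _; rewrite indicI.
  rewrite /Rintegral !integral_indic//; last exact: measurableI.
  rewrite !setIT -fineM ?fin_num_measure//; congr fine; exact: indB.
- have i1 := span_integrable _ s1; have i2 := span_integrable _ s2.
  have j1 := intB _ s1; have j2 := intB _ s2.
  under eq_Rintegral do rewrite mulrDl -!mulrA.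
  rewrite RintegralD ?RintegralZl ?IH1 ?IH2//; last 2 first.
  + by apply: eq_integrable (integrableZl _ a j1).
  + by apply: eq_integrable (integrableZl _ b j2).
  rewrite RintegralD ?RintegralZl//; last 2 first.
  + by apply: eq_integrable (integrableZl _ a i1).
  + by apply: eq_integrable (integrableZl _ b i2).
  by rewrite mulrDl !mulrA.
- have mf1 := span_measurable _ s1.
  rewrite -(ae_eq_Rintegral f1 f2)// -IH1; apply/esym/ae_eq_Rintegral.
  + exact: measurable_funM.
  + exact: measurable_funM.
  + by apply: filterS f12 => w ->.
Qed.

End indicator_span.

(** * Events of the past of the walk *)

Section past_events.
Context {d} {T : measurableType d} {R : realType} (P : probability T R).
Context {d'} {V : measurableType d'} (Z : nat -> T -> V).

(** Cylinders are stable under intersection, and mutual independence speaks of them directly,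
    without passing to the sigma-algebra they generate. The sets [B k] outside the index range are
    free. *)
Definition past_events (n : nat) : set (set T) :=
  [set A | exists2 B : nat -> set V, (forall k, measurable (B k)) &
    A = \bigcap_(k in [set k | (2 <= k <= n)%N]) Z k @^-1` B k].

Lemma past_events_setT n : past_events n setT.
Proof. by exists (fun=> setT) => //; apply/seteqP; split. Qed.

Lemma past_eventsI n A B : past_events n A -> past_events n B -> past_events n (A `&` B).
Proof.
move=> [A' mA ->] [B' mB ->]; exists (fun k => A' k `&` B' k).
  by move=> k; exact: measurableI.
by rewrite -bigcapI; apply: eq_bigcapr => k _; rewrite preimage_setI.
Qed.

Lemma past_events_le m n : (m <= n)%N -> past_events m `<=` past_events n.
Proof.
move=> mn A [B mB ->]; exists (fun k => if (k <= m)%N then B k else setT).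
  by move=> k; case: ifP.
apply/seteqP; split => w h k /= /andP[k2 kn].
  by case: ifP => // km; apply: h; rewrite /= k2.
by have := h k; rewrite /= k2 kn (leq_trans kn mn) => /(_ isT).
Qed.

Lemma past_events_preimage n k B : (2 <= k <= n)%N -> measurable B ->
  past_events n (Z k @^-1` B).
Proof.
move=> kn mB; exists (fun j => if j == k then B else setT).
  by move=> j; case: ifP.
apply/seteqP; split => w /=.
  by move=> h j _ /=; case: eqP => // ->.
by move=> /(_ k kn); rewrite /= eqxx.
Qed.

Lemma past_events_sigma n : past_events n `<=` sigma_process (indices_from 2) Z.
Proof.
move=> A [B mB ->].
pose G := \bigcup_(n in indices_from 2) sigma_rv (Z n).
apply: (@bigcap_measurableType _ (g_sigma_algebraType G)) => k /andP[k2 _].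
by apply: sub_sigma_algebra; exists k => //; exists (B k) => //; rewrite setTI.
Qed.

Lemma past_events_independent n A B : independent_seq P (indices_from 2) Z ->
  (1 <= n)%N -> past_events n A -> measurable B ->
  P (A `&` Z n.+1 @^-1` B) = (P A * P (Z n.+1 @^-1` B))%E.
Proof.
move=> indZ n1 [C mC ->] mB.
(* One family holds both the coordinate events of [A] and the new event, so that independence over
   [J] and over [J] with [n.+1] added yields the two products to compare. *)
pose E k := if k == n.+1 then Z n.+1 @^-1` B else Z k @^-1` C k.
pose J : {fset nat} := [fset k in iota 2 n.-1]%fset.
have JE k : (k \in J) = (2 <= k <= n)%N.
  by rewrite !inE mem_iota; apply/idP/idP; lia.
have EF k : indices_from 2 k -> sigma_rv (Z k) (E k).
  move=> _; rewrite /E; case: eqP => [->|_].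
    by exists B => //; rewrite setTI.
  by exists (C k) => //; rewrite setTI.
have capJ : \bigcap_(k in [set k | (2 <= k <= n)%N]) Z k @^-1` C k =
    \bigcap_(k in [set` J]) E k.
  apply/seteqP; split => w h k /= => [|kn].
    rewrite JE => kn; rewrite /E ifF; first exact: h.
    by apply/eqP => kE; move: kn; rewrite kE; lia.
  have := h k; rewrite /= JE /E ifF; first by apply.
  by apply/eqP => kE; move: kn; rewrite kE; lia.
have nJ : n.+1 \notin J by rewrite JE; lia.
have capJ' : (\bigcap_(k in [set` J]) E k) `&` Z n.+1 @^-1` B =
    \bigcap_(k in [set` (n.+1 |` J)%fset]) E k.
  apply/seteqP; split => w.
    move=> [h hn] k /=; rewrite in_fset1U => /orP[/eqP->|kJ]; last exact: h.
    by rewrite /E eqxx.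
  move=> h; split => [k /= kJ|]; first by apply: h; rewrite /= in_fset1U kJ orbT.
  by have := h n.+1; rewrite /= in_fset1U eqxx /E eqxx; apply.
rewrite capJ capJ' !indZ.
- by rewrite big_fsetU1//= muleC {2}/E eqxx.
- by move=> k /=; rewrite JE => /andP[].
- by move=> k; rewrite JE => /andP[k2 _]; apply: EF.
- move=> k /=; rewrite in_fset1U JE => /orP[/eqP->|/andP[]//].
  by rewrite /indices_from /= ltnS.
- move=> k; rewrite in_fset1U JE => h; apply: EF; rewrite /indices_from /=.
  by move: h => /orP[/eqP->|/andP[]//]; rewrite ltnS.
Qed.

End past_events.

Section history.
Context {d} {T : measurableType d} {R : realType} (P : probability T R).
Context (p lambda : R) (D : nat -> T -> set nat).
Context (X Y eps : nat -> {RV P >-> R}) (I : nat -> {RV P >-> nat}).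
Hypothesis hX : TMERW p lambda D X Y eps I.

Lemma tmerw_five_events A1 A2 A3 A4 A5 :
  sigma_rv (X 1%N) A1 -> sigma_sets D A2 ->
  sigma_process (indices_from 2) Y A3 -> sigma_process (indices_from 2) eps A4 ->
  sigma_process (indices_from 2) I A5 ->
  P (A1 `&` A2 `&` A3 `&` A4 `&` A5) = (P A1 * P A2 * P A3 * P A4 * P A5)%E.
Proof.
move=> h1 h2 h3 h4 h5.
pose E (i : 'I_5) := tnth [tuple A1; A2; A3; A4; A5] i.
pose J : {fset 'I_5} := [fset i in enum 'I_5]%fset.
have JE i : i \in J by rewrite !inE mem_enum.
have capE : A1 `&` A2 `&` A3 `&` A4 `&` A5 = \bigcap_(i in [set` J]) E i.
  apply/seteqP; split => w.
    by move=> [[[[w1 w2] w3] w4] w5] [[|[|[|[|[|//]]]]] i5] _; rewrite /E (tnth_nth A1).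
  move=> h; have hE k (k5 : (k < 5)%N) : nth A1 [:: A1; A2; A3; A4; A5] k w.
    by have := h (Ordinal k5) (JE _); rewrite /E (tnth_nth A1).
  by do ![split]; [exact: (hE 0%N)|exact: (hE 1%N)|exact: (hE 2)|exact: (hE 3)|exact: (hE 4)].
rewrite capE (tmerw_indep hX) => //; last first.
  move=> [[|[|[|[|[|//]]]]] i5] _; rewrite /E !(tnth_nth A1) (tnth_nth set0) /=//.
rewrite (perm_big (enum 'I_5)) /=; last first.
  apply: uniq_perm; [exact: fset_uniq|exact: enum_uniq|].
  by move=> i; rewrite JE mem_enum.
rewrite big_enum /= !big_ord_recl big_ord0 mule1 /E !(tnth_nth A1) /= !muleA //.
Qed.

(* Only Y, eps and I are cut off at time n: the whole sequence D is included,
   since the drift of the walk is computed conditionally on it. *)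
Definition history (n : nat) : set (set T) :=
  [set A | exists A1 A2 A3 A4 A5, A = A1 `&` A2 `&` A3 `&` A4 `&` A5 /\
    [/\ sigma_rv (X 1%N) A1, sigma_sets D A2, past_events Y n A3,
        past_events eps n A4 & past_events I n A5]].

Lemma sigma_rvT : sigma_rv (X 1%N) setT.
Proof. by exists setT => //; rewrite setTI. Qed.

Lemma sigma_rvI A B : sigma_rv (X 1%N) A -> sigma_rv (X 1%N) B ->
  sigma_rv (X 1%N) (A `&` B).
Proof.
move=> [A' mA <-] [B' mB <-]; exists (A' `&` B'); first exact: measurableI.
by rewrite !setTI.
Qed.

Lemma sigma_setsT : sigma_sets D setT.
Proof. exact: (@measurableT _ (g_sigma_algebraType _)). Qed.

Lemma sigma_setsI A B : sigma_sets D A -> sigma_sets D B -> sigma_sets D (A `&` B).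
Proof. exact: (@measurableI _ (g_sigma_algebraType _)). Qed.

Lemma history_setT n : history n setT.
Proof.
exists setT, setT, setT, setT, setT; rewrite !setIT; split => //; split.
- exact: sigma_rvT.
- exact: sigma_setsT.
- exact: past_events_setT.
- exact: past_events_setT.
- exact: past_events_setT.
Qed.

Lemma historyI n A B : history n A -> history n B -> history n (A `&` B).
Proof.
move=> [A1 [A2 [A3 [A4 [A5 [-> [a1 a2 a3 a4 a5]]]]]]].
move=> [B1 [B2 [B3 [B4 [B5 [-> [b1 b2 b3 b4 b5]]]]]]].
exists (A1 `&` B1), (A2 `&` B2), (A3 `&` B3), (A4 `&` B4), (A5 `&` B5); split.
  apply/seteqP; split => w /=; tauto.
split; [exact: sigma_rvI|exact: sigma_setsI|exact: past_eventsI..].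
Qed.

Lemma history_le m n : (m <= n)%N -> history m `<=` history n.
Proof.
move=> mn A [A1 [A2 [A3 [A4 [A5 [-> [a1 a2 a3 a4 a5]]]]]]].
by exists A1, A2, A3, A4, A5; split => //; split => //; apply: (past_events_le _ _ _ mn).
Qed.

Lemma history_X1 n B : measurable B -> history n (X 1%N @^-1` B).
Proof.
move=> mB; exists (X 1%N @^-1` B), setT, setT, setT, setT; rewrite !setIT; split => //.
split; [by exists B => //; rewrite setTI|exact: sigma_setsT|exact: past_events_setT..].
Qed.

Lemma history_D n A : sigma_sets D A -> history n A.
Proof.
move=> sA; exists setT, A, setT, setT, setT; rewrite !setIT setTI; split => //.
split; [exact: sigma_rvT|exact: sA|exact: past_events_setT..].
Qed.

Lemma history_Y n k B : (2 <= k <= n)%N -> measurable B -> history n (Y k @^-1` B).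
Proof.
move=> kn mB; exists setT, setT, (Y k @^-1` B), setT, setT; rewrite !setIT !setTI.
split => //; split; [exact: sigma_rvT|exact: sigma_setsT| |exact: past_events_setT..].
exact: past_events_preimage.
Qed.

Lemma history_eps n k B : (2 <= k <= n)%N -> measurable B -> history n (eps k @^-1` B).
Proof.
move=> kn mB; exists setT, setT, setT, (eps k @^-1` B), setT; rewrite !setIT !setTI.
split => //; split; [exact: sigma_rvT|exact: sigma_setsT|exact: past_events_setT| |].
  exact: past_events_preimage.
exact: past_events_setT.
Qed.

Lemma history_I n k B : (2 <= k <= n)%N -> measurable B -> history n (I k @^-1` B).
Proof.
move=> kn mB; exists setT, setT, setT, setT, (I k @^-1` B); rewrite !setTI.
split => //; split; [exact: sigma_rvT|exact: sigma_setsT|exact: past_events_setT..|].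
exact: past_events_preimage.
Qed.

Lemma past_events_measurable d' (V : measurableType d') (Z : nat -> {mfun T >-> V}) n :
  past_events (fun k => Z k) n `<=` measurable.
Proof.
move=> A [B mB ->]; apply: bigcap_measurableType => k _.
by rewrite -[X in measurable X]setTI; exact: measurable_funP.
Qed.

Lemma history_measurable n : history n `<=` measurable.
Proof.
move=> A [A1 [A2 [A3 [A4 [A5 [-> [a1 a2 a3 a4 a5]]]]]]].
apply: measurableI; last exact: past_events_measurable a5.
apply: measurableI; last exact: past_events_measurable a4.
apply: measurableI; last exact: past_events_measurable a3.
apply: measurableI; first by case: a1 => B mB <-; exact: measurable_funP.
apply: (smallest_sub _ _ a2) => [|B [m [k [m1 ->]]]].
  exact: sigma_algebra_measurable.
exact: tmerw_D_meas hX _ _ m1.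
Qed.

(** Each new event is grouped with the past of its own sequence. Independence of the five sources
    then splits both sides, and independence within each sequence detaches the new factor. *)
Lemma history_independent n A BY Be BI : (1 <= n)%N -> history n A ->
  measurable BY -> measurable Be -> measurable BI ->
  P (A `&` (Y n.+1 @^-1` BY `&` eps n.+1 @^-1` Be `&` I n.+1 @^-1` BI)) =
  (P A * (P (Y n.+1 @^-1` BY) * P (eps n.+1 @^-1` Be) * P (I n.+1 @^-1` BI)))%E.
Proof.
move=> n1 [A1 [A2 [A3 [A4 [A5 [-> [a1 a2 a3 a4 a5]]]]]]] mY me mI.
have -> : A1 `&` A2 `&` A3 `&` A4 `&` A5 `&`
    (Y n.+1 @^-1` BY `&` eps n.+1 @^-1` Be `&` I n.+1 @^-1` BI) =
    A1 `&` A2 `&` (A3 `&` Y n.+1 @^-1` BY) `&` (A4 `&` eps n.+1 @^-1` Be) `&`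
      (A5 `&` I n.+1 @^-1` BI).
  by apply/seteqP; split => w /=; tauto.
have n2 : (2 <= n.+1 <= n.+1)%N by rewrite leqnn ltnS n1.
have sub d' (V : measurableType d') (Z : nat -> T -> V) B C : past_events Z n B ->
    measurable C -> sigma_process (indices_from 2) Z (B `&` Z n.+1 @^-1` C).
  move=> pB mC; apply: (past_events_sigma _ n.+1); apply: past_eventsI.
    exact: past_events_le pB.
  exact: past_events_preimage.
rewrite !tmerw_five_events//; try exact: sub; try exact: (past_events_sigma _ n).
rewrite (past_events_independent P Y n)//; last by case: (tmerw_Y_iid hX).
rewrite (past_events_independent P eps n)//; last by case: (tmerw_eps_iid hX).
rewrite (past_events_independent P I n)//; last exact: (tmerw_I_indep hX).
have reorder (a b c u y e z : \bar R) :
    (a * (b * y) * (c * e) * (u * z) = a * b * c * u * (y * e * z))%E.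
  by rewrite -(muleACA (a * b * c)%E) -(muleACA (a * b)%E) !muleA.
exact: reorder.
Qed.

End history.

(** * Increments of the walk *)

Section increments.
Context {d} {T : measurableType d} {R : realType} (P : probability T R).

Lemma ae_of_probability1 (A : set T) : measurable A -> P A = 1%E ->
  {ae P, forall w, A w}.
Proof.
move=> mA PA; exists (~` A); split => //; first exact: measurableC.
by rewrite -[LHS]/(P (~` A)) probability_setC// PA subee.
Qed.

Lemma preimage_measurable d' (V : measurableType d') (Z : {mfun T >-> V}) B :
  measurable B -> measurable (Z @^-1` B).
Proof. by move=> mB; rewrite -[X in measurable X]setTI; exact: measurable_funP. Qed.

Lemma sign_law_ae (q : R) (Z : {RV P >-> R}) : sign_law P q Z ->
  {ae P, forall w, Z w = 1 \/ Z w = -1}.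
Proof.
move=> [Z1 Z2].
have m1 x : measurable [set w | Z w = x].
  exact: (preimage_measurable _ _ Z _ (measurable_set1 x)).
have U1 : P ([set w | Z w = 1] `|` [set w | Z w = -1]) = 1%E.
  rewrite measureU//; last first.
    rewrite -subset0 => w /= [->] /eqP; rewrite -subr_eq0 opprK.
    by rewrite -(natrD _ 1 1) pnatr_eq0.
  by rewrite [X in (X + _)%E]Z1 [X in (_ + X)%E]Z2 -EFinD addrC subrK.
by apply: filterS (ae_of_probability1 _ (measurableU _ _ (m1 1) (m1 (-1))) U1) => w.
Qed.

Lemma Rintegral_sum n (f : nat -> T -> R) :
  (forall k, (k < n)%N -> P.-integrable setT (EFin \o f k)) ->
  P.-integrable setT (EFin \o (fun w => \sum_(k < n) f k w)) /\
  \int[P]_w (\sum_(k < n) f k w) = \sum_(k < n) \int[P]_w f k w.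
Proof.
elim: n => [|n IH] intf.
  split.
    by apply: eq_integrable (integrable0 _ _) => // w _; rewrite /= big_ord0.
  rewrite big_ord0 (@eq_Rintegral _ _ _ P setT (fun=> 0)) ?Rintegral_cst ?mul0r// => w _.
  by rewrite big_ord0.
have [i1 e1] := IH (fun k kn => intf k (ltnW kn)).
have in_ := intf n (leqnn _).
split.
  by apply: eq_integrable (integrableD _ i1 in_) => // w _; rewrite /= big_ord_recr EFinD.
rewrite big_ord_recr /= -e1 -RintegralD//; apply: eq_Rintegral => w _.
by rewrite big_ord_recr.
Qed.

Context (p lambda : R) (L : nat -> {RV P >-> bool}).
Context (X Y eps : nat -> {RV P >-> R}) (I : nat -> {RV P >-> nat}).
Hypothesis hX : TMERW p lambda (zeros_upto L) X Y eps I.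

Local Notation hist := (history P (zeros_upto L) X Y eps I).
Local Notation span n := (indicator_span P (hist n)).

Lemma innovations_ae : {ae P, forall w, forall n, (1 <= n)%N ->
  [/\ (1 <= I n.+1 w <= n)%N, eps n.+1 w = 1 \/ eps n.+1 w = -1 &
      Y n.+1 w = 1 \/ Y n.+1 w = -1]}.
Proof.
apply: ae_foralln => n; have [->|n0] := posnP n; first exact: aeW.
have h1 := sign_law_ae _ _ (tmerw_eps_law hX (n0 : (2 <= n.+1)%N)).
have h2 := sign_law_ae _ _ (tmerw_Y_law hX (n0 : (2 <= n.+1)%N)).
suff h3 : {ae P, forall w, (1 <= I n.+1 w <= n)%N}.
  by apply: filterS3 h1 h2 h3.
have mI k : measurable [set w | I n.+1 w = k].
  exact: (preimage_measurable _ _ (I n.+1) [set k]).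
have U1 : P (\big[setU/set0]_(k < n) [set w | I n.+1 w = k.+1]) = 1%E.
  rewrite measure_bigsetU_ord//; last first.
    apply/trivIsetP => i j _ _ ij; rewrite -subset0 => w /= [->] [] /val_inj ji.
    by rewrite ji eqxx in ij.
  rewrite (eq_bigr (fun=> (n%:R^-1)%:E)) => [|k _].
    rewrite sumEFin sumr_const card_ord -[_ *+ n]mulr_natr mulVf//.
    by rewrite pnatr_eq0 -lt0n.
  by apply: (tmerw_I_law hX); rewrite /= ltn_ord.
apply: filterS (ae_of_probability1 _ (bigsetU_measurable _ _) U1) => [w|k _]; last exact: mI.
rewrite -(bigcup_mkord n (fun k => [set w | I n.+1 w = k.+1])) => -[k /= kn ->].
by rewrite ltnS kn.
Qed.

(** A stand-in for a variable with values 1 and -1 almost surely: unlike the variable itself, it is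
    exactly a combination of indicators. *)
Definition sign_of (A : set T) (w : T) : R := 2 * \1_A w - 1.

(** The part of [X n.+1] on the event that time [k.+1] is recalled. Writing the case distinction of
    the walk as a polynomial in indicators lets the product rule apply term by term. *)
Definition recollection (n k : nat) (w : T) : R :=
  \1_(I n.+1 @^-1` [set k.+1]) w *
  ((L k.+1 w)%:R * X k.+1 w * sign_of (eps n.+1 @^-1` [set 1]) w +
   (~~ L k.+1 w)%:R * sign_of (Y n.+1 @^-1` [set 1]) w).

Lemma sign_ofE (Z : T -> R) w : Z w = 1 \/ Z w = -1 ->
  sign_of (Z @^-1` [set 1]) w = Z w.
Proof.
rewrite /sign_of indicE => -[] Zw; rewrite Zw.
  by rewrite mem_set// mulr1; lra.
rewrite memNset/=; first by rewrite mulr0 sub0r.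
by rewrite Zw => h; lra.
Qed.

Lemma recollection_sum : {ae P, forall w, forall n, (1 <= n)%N ->
  \sum_(k < n) recollection n k w = X n.+1 w}.
Proof.
apply: filterS innovations_ae => w h n n1; have [In en Yn] := h n n1.
case EI : (I n.+1 w) => [|k0]; first by rewrite EI in In.
have k0n : (k0 < n)%N by move: In; rewrite EI => /andP[].
rewrite (bigD1 (Ordinal k0n))//= big1 ?addr0; last first.
  move=> k kk0; rewrite /recollection indicE memNset/= ?mul0r// EI => -[] kE.
  by move: kk0; rewrite -val_eqE /= kE eqxx.
rewrite /recollection indicE mem_set//= mul1r !sign_ofE//.
case E : (L k0.+1 w).
  rewrite mul1r mul0r addr0 (tmerw_step_memory hX n1) ?EI 1?mulrC//.
  by move=> [_]; rewrite E.
rewrite !mul0r add0r mul1r (tmerw_step_innovation hX n1)//.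
by rewrite EI; split.
Qed.

(** [L k.+1] vanishes exactly when [k.+1] lies in the memory set [D] of index [k.+1]. As all of [D]
    belongs to the history, this holds for every [k], also beyond [n]. *)
Lemma history_L n k : hist n [set w | L k.+1 w] /\ hist n [set w | ~~ L k.+1 w].
Proof.
have sL : sigma_sets (zeros_upto L) [set w | ~~ L k.+1 w].
  apply: sub_sigma_algebra; exists k.+1, k.+1; split => //.
  by apply/seteqP; split => w; rewrite /zeros_upto /= leqnn; [move=> /negbTE ->|move=> [_ ->]].
split; last exact: history_D.
apply: history_D; rewrite (_ : [set _ | _] = ~` [set w | ~~ L k.+1 w]).
  exact: sigma_algebraC.
by apply/seteqP; split => w /=; case: (L k.+1 w) => // /(_ isT).
Qed.

Let C_meas n := history_measurable P p lambda (zeros_upto L) X Y eps I hX n.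
Let C_T n := history_setT P (zeros_upto L) X Y eps I n.
Let C_I n := historyI P (zeros_upto L) X Y eps I n.

Let hspanM n f g : span n f -> span n g -> span n (fun w => f w * g w).
Proof. exact: (spanM P (hist n) (C_meas n) (C_I n)). Qed.

Lemma span_L n k : span n (fun w => (L k.+1 w)%:R).
Proof.
apply: (eq_span _ _ _ _ (span_indic _ _ _ (history_L n k).1)) => w.
rewrite indicE; case E : (L k.+1 w); [rewrite mem_set//=|rewrite memNset//=].
by rewrite E.
Qed.

Lemma span_notL n k : span n (fun w => (~~ L k.+1 w)%:R).
Proof.
apply: (eq_span _ _ _ _ (span_indic _ _ _ (history_L n k).2)) => w.
rewrite indicE; case E : (L k.+1 w); [rewrite memNset//=|rewrite mem_set//=].
  by rewrite E.
by rewrite E.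
Qed.

Lemma span_sign n A : hist n A -> span n (sign_of A).
Proof.
move=> hA; apply: spanB; last exact: span_cst.
by apply: spanZ; exact: span_indic.
Qed.

Lemma span_le m n f : (m <= n)%N -> span m f -> span n f.
Proof. by move=> mn; apply: indicator_span_sub; exact: history_le. Qed.

Lemma span_recollection n k : (k < n)%N -> span k.+1 (X k.+1) ->
  span n.+1 (recollection n k).
Proof.
move=> kn sX.
have n2 : (2 <= n.+1 <= n.+1)%N by rewrite leqnn ltnS (leq_ltn_trans _ kn).
rewrite /recollection; apply: hspanM.
  by apply: span_indic; exact: history_I.
apply: spanD; apply: hspanM.
- apply: hspanM; first exact: span_L.
  by apply: span_le sX; rewrite ltnW.
- by apply: span_sign; exact: history_eps.
- exact: span_notL.
- by apply: span_sign; exact: history_Y.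
Qed.

(** Strong induction along the recursion of the walk: almost everywhere [X n.+2] is the sum of its
    recollections, each a product of an earlier position and new indicators. *)
Lemma span_X n : span n.+1 (X n.+1).
Proof.
elim/ltn_ind: n => -[_|n IH].
  apply: (eq_span _ _ (sign_of (X 1%N @^-1` [set 1]))) => [|w].
    by apply: span_sign; exact: history_X1.
  exact/sign_ofE/(tmerw_X1 hX).
apply: (span_ae _ _ (fun w => \sum_(k < n.+1) recollection n.+1 k w)).
- apply: span_sum => // k kn; apply: span_recollection => //; exact: IH.
- exact: measurable_funP.
- by apply: filterS recollection_sum => w h; exact: h.
Qed.

Lemma span_Rintegral_lin n a b f g : span n f -> span n g ->
  \int[P]_w (a * f w + b * g w) = a * \int[P]_w f w + b * \int[P]_w g w.
Proof.
move=> sf sg.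
have intf := span_integrable P (hist n) (C_meas n) _ sf.
have intg := span_integrable P (hist n) (C_meas n) _ sg.
rewrite RintegralD ?RintegralZl//.
- by apply: eq_integrable (integrableZl _ a intf).
- by apply: eq_integrable (integrableZl _ b intg).
Qed.

Lemma span_innovation n f BY Be BI : (1 <= n)%N -> span n f ->
  measurable BY -> measurable Be -> measurable BI ->
  \int[P]_w (f w * \1_(Y n.+1 @^-1` BY `&` eps n.+1 @^-1` Be `&` I n.+1 @^-1` BI) w) =
  \int[P]_w f w * (fine (P (Y n.+1 @^-1` BY)) * fine (P (eps n.+1 @^-1` Be)) *
    fine (P (I n.+1 @^-1` BI))).
Proof.
move=> n1 sf mY me mI.
have ind := history_independent P p lambda (zeros_upto L) X Y eps I hX n _ BY Be BI n1.
have PB := ind setT (C_T n) mY me mI; rewrite setTI probability_setT mul1e in PB.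
rewrite (span_independent P (hist n))//.
- by congr (_ * _); rewrite [X in fine X]PB !fineM ?fin_numM ?fin_num_measure//;
    exact: preimage_measurable.
- apply: measurableI; last exact: preimage_measurable.
  by apply: measurableI; exact: preimage_measurable.
- by move=> A hA; rewrite [X in (_ * X)%E]PB; exact: ind.
Qed.

Lemma recollection_mean n k g : (1 <= n)%N -> (k < n)%N -> span n g ->
  \int[P]_w (g w * recollection n k w) =
  (2 * p - 1) / n%:R * \int[P]_w (g w * ((L k.+1 w)%:R * X k.+1 w)) +
  (2 * lambda - 1) / n%:R * \int[P]_w (g w * (~~ L k.+1 w)%:R).
Proof.
move=> n1 kn sg.
pose f1 w := g w * ((L k.+1 w)%:R * X k.+1 w).
pose f2 w := g w * (~~ L k.+1 w)%:R.
have s1 : span n f1.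
  apply: hspanM => //; apply: hspanM => //; first exact: span_L.
  by apply: span_le (span_X k).
have s2 : span n f2 by apply: hspanM => //; exact: span_notL.
pose B BY Be := Y n.+1 @^-1` BY `&` eps n.+1 @^-1` Be `&` I n.+1 @^-1` [set k.+1].
have m1 : measurable [set 1 : R] by exact: measurable_set1.
have n2 : (2 <= n.+1 <= n.+1)%N by rewrite leqnn ltnS n1.
have sB f BY Be : span n f -> measurable BY -> measurable Be ->
    span n.+1 (fun w => f w * \1_(B BY Be) w).
  move=> sf mY me; apply: hspanM => //; first by apply: span_le sf.
  apply: span_indic; apply: C_I; last exact: history_I.
  by apply: C_I; [exact: history_Y|exact: history_eps].
(* Expanding the signs leaves terms with one factor from the past and one joint event of the three
   new variables. The pairs 2p - 1 and 2 lambda - 1 arise from the coefficients 2 and -1. *)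
have split_rec w : g w * recollection n k w =
    1 * (2 * (f1 w * \1_(B setT [set 1]) w) + (-1) * (f1 w * \1_(B setT setT) w)) +
    1 * (2 * (f2 w * \1_(B [set 1] setT) w) + (-1) * (f2 w * \1_(B setT setT) w)).
  rewrite /recollection /sign_of /f1 /f2 /B !preimage_setT !setTI setIT !indicI /=.
  ring.
rewrite (eq_Rintegral _ (fun w _ => split_rec w)).
rewrite (span_Rintegral_lin n.+1); try (by apply: span_lin; apply: sB).
rewrite !(span_Rintegral_lin n.+1); try exact: sB.
rewrite !span_innovation//.
have PT (Z : {RV P >-> R}) : fine (P (Z @^-1` setT)) = 1.
  by rewrite preimage_setT probability_setT.
have PI : fine (P (I n.+1 @^-1` [set k.+1])) = n%:R^-1.
  by rewrite [X in fine X](tmerw_I_law hX)//= kn.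
have PE : fine (P (eps n.+1 @^-1` [set 1])) = p.
  by rewrite [X in fine X](tmerw_eps_law hX (n1 : (2 <= n.+1)%N)).1.
have PY : fine (P (Y n.+1 @^-1` [set 1])) = lambda.
  by rewrite [X in fine X](tmerw_Y_law hX (n1 : (2 <= n.+1)%N)).1.
rewrite !PT PI PE PY; ring.
Qed.

(** For [1 <= n] this is the conditional mean of [X n.+1] given the history. At [n = 0] division by
    zero makes it 0, which need not be the mean of [X 1]; this is harmless, as orthogonality of a
    pair uses centring at the later index only. *)
Definition drift (n : nat) (w : T) : R :=
  (2 * p - 1) * average (fun k => (L k.+1 w)%:R * X k.+1 w) n +
  (2 * lambda - 1) * average (fun k => (~~ L k.+1 w)%:R) n.

Lemma span_drift n : span n (drift n).
Proof.
apply: (eq_span _ _ (fun w =>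
  (2 * p - 1) * (n%:R^-1 * \sum_(k < n) ((L k.+1 w)%:R * X k.+1 w)) +
  (2 * lambda - 1) * (n%:R^-1 * \sum_(k < n) (~~ L k.+1 w)%:R))) => [|w]; last first.
  by rewrite /drift /average ![_ / _]mulrC.
apply: span_lin; apply: spanZ.
  apply: (span_sum P (hist n) (C_T n) n (fun k w => (L k.+1 w)%:R * X k.+1 w)) => k kn.
  by apply: hspanM; [exact: span_L|exact: span_le (span_X k)].
apply: (span_sum P (hist n) (C_T n) n (fun k w => (~~ L k.+1 w)%:R)) => k kn.
exact: span_notL.
Qed.

(** The conditional expectation in weak form, tested against the elements of the span. *)
Lemma conditional_mean n g : (1 <= n)%N -> span n g ->
  \int[P]_w (g w * X n.+1 w) = \int[P]_w (g w * drift n w).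
Proof.
move=> n1 sg.
have sgS : span n.+1 g by exact: span_le sg.
have sgr k : (k < n)%N -> span n.+1 (fun w => g w * recollection n k w).
  by move=> kn; apply: hspanM => //; apply: span_recollection => //; exact: span_X.
have [ir er] := Rintegral_sum n (fun k w => g w * recollection n k w)
  (fun k kn => span_integrable P (hist n.+1) (C_meas n.+1) _ (sgr k kn)).
rewrite (ae_eq_Rintegral P _ (fun w => \sum_(k < n) (g w * recollection n k w))); last first.
- apply: filterS recollection_sum => w h.
  by rewrite -mulr_sumr h.
- apply: (span_measurable P (hist n.+1) (C_meas n.+1)).
  exact: (span_sum P (hist n.+1) (C_T n.+1) n (fun k w => g w * recollection n k w)).
- apply: (span_measurable P (hist n.+1) (C_meas n.+1)); apply: hspanM => //.
  exact: span_X.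
rewrite er.
pose h k w := (2 * p - 1) / n%:R * (g w * ((L k.+1 w)%:R * X k.+1 w)) +
  (2 * lambda - 1) / n%:R * (g w * (~~ L k.+1 w)%:R).
have s1 k : (k < n)%N -> span n (fun w => g w * ((L k.+1 w)%:R * X k.+1 w)).
  move=> kn; apply: hspanM => //; apply: hspanM => //; first exact: span_L.
  by apply: span_le (span_X k).
have s2 k : span n (fun w => g w * (~~ L k.+1 w)%:R).
  by apply: hspanM => //; exact: span_notL.
have sh k : (k < n)%N -> span n (h k).
  by move=> kn; apply: span_lin; [exact: s1|exact: s2].
have [ih eh] := Rintegral_sum n h
  (fun k kn => span_integrable P (hist n) (C_meas n) _ (sh k kn)).
rewrite (@eq_Rintegral _ _ _ P setT (fun w => \sum_(k < n) h k w)) => [|w _].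
  rewrite eh; apply: eq_bigr => k _.
  by rewrite recollection_mean// (span_Rintegral_lin n)//; exact: s1.
rewrite /drift /average /h big_split /= -!mulr_sumr; ring.
Qed.

Lemma X_norm_le1 : {ae P, forall w, forall n, `|X n.+1 w| <= 1}.
Proof.
have pm1 (y : R) : y = 1 \/ y = -1 -> `|y| = 1 by case=> ->; rewrite ?normrN normr1.
apply: filterS innovations_ae => w h; elim/ltn_ind => -[_|n IH].
  by rewrite pm1//; exact: (tmerw_X1 hX).
have [] := h n.+1 isT; case EI : (I n.+2 w) => [//|k] kn /pm1 e1 /pm1 y1.
have [Dk|Dk] := pselect (zeros_upto L n.+1 w (I n.+2 w)).
  by rewrite (tmerw_step_innovation hX _ Dk)// y1.
by rewrite (tmerw_step_memory hX _ Dk)// normrM e1 mul1r EI IH.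
Qed.

(** The weights must be predictable; membership in the span at every time is available for the two
    cases of interest, the constant 1 and the sequence [L]. *)
Lemma noise_average_cvg0 (c : nat -> T -> R) : 0 <= p <= 1 -> 0 <= lambda <= 1 ->
  (forall m n, span n (c m)) -> (forall m w, `|c m w| <= 1) ->
  {ae P, forall w, average (fun k => c k w * (X k.+1 w - drift k w)) n
    @[n --> \oo] --> (0 : R)}.
Proof.
move=> /andP[p0 p1] /andP[l0 l1] sc c1.
pose f k w := c k w * (X k.+1 w - drift k w).
have sf k : span k.+1 (f k).
  apply: hspanM => //; apply: spanB; first exact: span_X.
  exact: span_le (span_drift k).
(* The drift is at most 2 in absolute value, each average having a coefficient of modulus at most 1;
   with [X] this gives 3, and 9 for products. *)
have f3 : {ae P, forall w, forall k, `|f k w| <= 3}.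
  apply: filterS X_norm_le1 => w X1 k.
  have W1 : `|average (fun k => (L k.+1 w)%:R * X k.+1 w) k| <= 1.
    apply: average_norm_le1 => j _; rewrite normrM.
    by case: (L j.+1 w); rewrite ?normr1 ?normr0 ?mul1r ?mul0r.
  have Z1 : `|average (fun k => (~~ L k.+1 w)%:R) k : R| <= 1.
    by apply: average_norm_le1 => j _; case: (L j.+1 w); rewrite ?normr1 ?normr0.
  have b1 : `|2 * p - 1| <= 1 by rewrite ler_norml; apply/andP; split; lra.
  have g1 : `|2 * lambda - 1| <= 1 by rewrite ler_norml; apply/andP; split; lra.
  have D2 : `|drift k w| <= 2.
    apply: le_trans (ler_normD _ _) _; rewrite normrM [X in _ + X <= _]normrM.
    have h1 := ler_pM (normr_ge0 _) (normr_ge0 _) b1 W1.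
    have h2 := ler_pM (normr_ge0 _) (normr_ge0 _) g1 Z1.
    by have := lerD h1 h2; rewrite !mul1r => /le_trans; apply.
  rewrite /f normrM.
  have h3 : `|X k.+1 w - drift k w| <= 3.
    by apply: le_trans (ler_normB _ _) _; have := X1 k; lra.
  have := ler_pM (normr_ge0 _) (normr_ge0 _) (c1 k w) h3.
  by rewrite mul1r.
have mf k : measurable_fun setT (f k).
  exact: (span_measurable P (hist k.+1) (C_meas k.+1)).
have mff i j : measurable_fun setT (fun w => f i w * f j w) by exact: measurable_funM.
have ff9 i j : {ae P, forall w, `|f i w * f j w| <= 9}.
  apply: filterS f3 => w f3; rewrite normrM.
  by have := ler_pM (normr_ge0 _) (normr_ge0 _) (f3 i) (f3 j); rewrite -natrM.
apply: (ae_average_orthogonal_cvg0 P 3 9 f) => //.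
- move=> k; apply: filterS f3 => w /(_ k); rewrite ler_norml => /andP[] //.
- by move=> i j; apply: (ae_bounded_integrable P 9).
- move=> i j ij.
  (* For [i < j] the earlier noise times the later weight is known at time [j], hence an admissible
     test function for the conditional mean of [X j.+1]. *)
  have sg : span j (fun w => f i w * c j w).
    by apply: hspanM => //; apply: span_le (sf i).
  have j1 : (1 <= j)%N by rewrite (leq_trans _ ij).
  have sX : span j.+1 (fun w => (f i w * c j w) * X j.+1 w).
    by apply: hspanM; [apply: span_le sg|exact: span_X].
  have sD : span j.+1 (fun w => (f i w * c j w) * drift j w).
    apply: hspanM; first exact: span_le sg.
    exact: span_le (span_drift j).
  rewrite (@eq_Rintegral _ _ _ P setT (fun w => 1 * ((f i w * c j w) * X j.+1 w) +
    (-1) * ((f i w * c j w) * drift j w))) => [|w _]; last by rewrite {2}/f; ring.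
  by rewrite (span_Rintegral_lin j.+1)// conditional_mean// mul1r mulN1r subrr.
- by move=> i; apply: ae_bounded_Rintegral_le.
Qed.

End increments.

Theorem theorem1p8 (R : realType) (d : measure_display) (T : measurableType d)
    (P : probability T R) (p lambda : R)
    (hp : 0 <= p <= 1) (hlambda : 0 <= lambda <= 1)
    (L : nat -> {RV P >-> bool}) (X Y eps : nat -> {RV P >-> R})
    (I : nat -> {RV P >-> nat})
    (hL : renewal_structure L)
    (hX : TMERW p lambda (zeros_upto L) X Y eps I) :
  let mu := mean_tau L + mean_sigma L in
  {ae P, forall w,
    walk X n w / n%:R @[n --> \oo] -->
      (2 * lambda - 1) * mean_sigma L / (mu - (2 * p - 1) * mean_tau L)}.
Proof.
move=> mu.
have [tau0 sigma0 freq] := renewal_frequency P L hL.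
have noise1 : {ae P, forall w,
    average (fun k => 1 * (X k.+1 w - drift P p lambda L X k w)) n @[n --> \oo] --> (0 : R)}.
  apply: (noise_average_cvg0 P p lambda L X Y eps I hX (fun _ _ => 1)) => // [m n|m w].
    exact/span_cst/history_setT.
  by rewrite normr1.
have noiseL : {ae P, forall w,
    average (fun k => (L k.+1 w)%:R * (X k.+1 w - drift P p lambda L X k w)) n
    @[n --> \oo] --> (0 : R)}.
  apply: (noise_average_cvg0 P p lambda L X Y eps I hX (fun k w => (L k.+1 w)%:R)) => //.
    by move=> m n; exact: span_L.
  by move=> m w; case: (L _ _); rewrite ?normr1 ?normr0.
have XL : {ae P, forall w, (forall n, `|X n.+1 w| <= 1) /\
    average (fun k => (L k.+1 w)%:R) n @[n --> \oo] -->
      mean_tau L / (mean_tau L + mean_sigma L)}.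
  by apply: filterS2 (X_norm_le1 P p lambda L X Y eps I hX) freq.
apply: filterS3 XL noise1 noiseL => w [X1 Lw] n1 nL.
have mu0 : 0 < mu by rewrite /mu ltr_wpDl.
have a01 : 0 <= mean_tau L / mu < 1.
  by rewrite divr_ge0 ?(ltW mu0)// ltr_pdivrMr// mul1r /mu ltrDl.
have b1 : `|2 * p - 1| <= 1.
  by move: hp => /andP[p0 p1]; rewrite ler_norml; apply/andP; split; lra.
have den0 : 0 < mu - (2 * p - 1) * mean_tau L.
  rewrite subr_gt0; apply: le_lt_trans (_ : mean_tau L < mu).
    apply: le_trans (ler_norm _) _; rewrite normrM (ger0_norm tau0).
    by rewrite ler_piMl.
  by rewrite /mu ltrDl.
have := reinforced_average_cvg (2 * p - 1) (2 * lambda - 1) (mean_tau L / mu)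
  (fun k => L k.+1 w) (fun k => X k.+1 w) b1 a01 X1 Lw.
(* Division of numerator and denominator by [mu] expresses the limit through the frequency
   [mean_tau L / mu]. *)
have -> : (2 * lambda - 1) * mean_sigma L / (mu - (2 * p - 1) * mean_tau L) =
    (2 * lambda - 1) * (1 - mean_tau L / mu) / (1 - (2 * p - 1) * (mean_tau L / mu)).
  have -> : mean_sigma L = mu - mean_tau L by rewrite /mu addrC addKr.
  have e : 1 - (2 * p - 1) * (mean_tau L / mu) = (mu - (2 * p - 1) * mean_tau L) / mu.
    by field; rewrite gt_eqF.
  by rewrite e; field; rewrite !gt_eqF.
move=> h; have {}h := h _ nL; apply: cvg_trans (h _).
  apply: near_eq_cvg; near=> n.
  by rewrite /walk /average big_add1 big_mkord.
apply: cvg_trans n1; apply: near_eq_cvg; near=> n.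
by apply: eq_average => k _; rewrite mul1r.
Unshelve. all: by end_near. Qed.
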